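(* Let $(\Sigma,\mathcal{B},\mu)$ be a measure space and $H=L^2(\Sigma)$. Let $V_1$ and $V_2$ be two real locally convex topological vector spaces, and let $j_1:V_1\to L^2(\Sigma)$ and $j_2:V_2\to L^2(\Sigma)$ be two linear operators which are weak-to-weak continuous. Let $\varphi_1:V_1\to\mathbb{R}\cup\{+\infty\}$ and $\varphi_2:V_2\to\mathbb{R}\cup\{+\infty\}$ be two convex, proper, lower semicontinuous functionals which are, respectively, $j_1$- and $j_2$-elliptic. Assume that $j_1(D(\varphi_1))$ and $j_2(D(\varphi_2))$ are dense in $L^2(\Sigma)$, and let $S_1$ and $S_2$ be the semigroups on $L^2(\Sigma)$ generated by $(\varphi_1,j_1)$ and $(\varphi_2,j_2)$, respectively. In addition, suppose that $C\subseteq L^2(\Sigma)$ is a closed, convex set satisfying $u\wedge v\in C$ and $u\vee v\in C$ for every $u,v\in C$, and that the semigroups $S_1$ and $S_2$ leave $C$ invariant. Then the following assertions are equivalent: (1) For every $u,v\in C$ with $u\le v$ one has $S_1(t)u\le S_2(t)v$ for every $t\ge 0$. (2) For every $u_1,u_2\in C$ one has $$\varphi_1^H(u_1\wedge u_2)+\varphi_2^H(u_1\vee u_2)\le\varphi_1^H(u_1)+\varphi_2^H(u_2).$$ (3) For every $\hat u_1\in D(\varphi_1)$, $\hat u_2\in D(\varphi_2)$ with $u_1:=j_1(\hat u_1)\in C$ and $u_2:=j_2(\hat u_2)\in C$, there are $\hat v_1\in D(\varphi_1)$, $\hat v_2\in D(\varphi_2)$ such that $u_1\wedge u_2=j_1(\hat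 v_1)$, $u_1\vee u_2=j_2(\hat v_2)$ and $$\varphi_1(\hat v_1)+\varphi_2(\hat v_2)\le\varphi_1(\hat u_1)+\varphi_2(\hat u_2).$$
   Context: For a real locally convex space $V$, a linear weak-to-weak continuous $j:V\to H$ and $\varphi:V\to\mathbb{R}\cup\{+\infty\}$: $D(\varphi)=\{\varphi<+\infty\}$; $\varphi$ is proper if $D(\varphi)\neq\emptyset$, lower semicontinuous if all sublevels $\{\varphi\le c\}$, $c\in\mathbb{R}$, are closed, and coercive if all sublevels are relatively weakly compact; $\varphi$ is $j$-elliptic if there exists $\omega\ge 0$ such that $\hat u\mapsto\varphi(\hat u)+\frac{\omega}{2}\|j(\hat u)\|_H^2$ is convex and coercive. The $j$-subgradient of $\varphi$ is $$\partial_j\varphi=\Big\{(u,f)\in H\times H \;:\; \exists\,\hat u\in D(\varphi)\text{ with } j(\hat u)=u \text{ and, for every }\hat v\in V,\ \liminf_{t\searrow 0}\frac{\varphi(\hat u+t\hat v)-\varphi(\hat u)}{t}\ge\langle f,j(\hat v)\rangle_H\Big\}.$$ $\partial\psi$ denotes the classical subgradient of a functional $\psi$ on $H$ (the case $V=H$, $j=I$). For $i=1,2$, $\varphi_i^H:H\to\mathbb{R}\cup\{+\infty\}$ denotes a convex, proper, lower semicontinuous functional with $\partial_{j_i}\varphi_i\subseteq\partial\varphi_i^H$; it exists, is unique up to an additive constant, and modulo that constant $\varphi_i^H(u)=\inf\{\varphi_i(\hat u): j_i(\hat u)=u\}$. The semigroup generated by $(\varphi,j)$: for every $u_0\in\overline{j(D(\varphi))}$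 (here all of $L^2(\Sigma)$) the problem $\dot u+\partial_j\varphi(u)\ni 0$ a.e. on $(0,\infty)$, $u(0)=u_0$, has a unique solution $u\in C(\mathbb{R}_+;H)\cap W^{1,\infty}_{loc}((0,\infty);H)$, and $S(t)u_0:=u(t)$. A semigroup $S$ leaves $C$ invariant if $S(t)C\subseteq C$ for every $t\ge 0$. $L^2(\Sigma)$ (real-valued) carries the natural almost everywhere ordering with lattice operations $\wedge$ (infimum) and $\vee$ (supremum). *)

(* Defs.v *)
From HB Require Import structures.
From mathcomp Require Import all_boot all_order all_algebra.
From mathcomp Require Import all_classical all_reals all_analysis.
From mathcomp Require Import ess_sup_inf measurable_realfun.

Set Implicit Arguments.
Unset Strict Implicit.
Unset Printing Implicit Defensive.

Import Order.TTheory GRing.Theory Num.Theory.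
Import numFieldNormedType.Exports.

Local Open Scope classical_set_scope.
Local Open Scope ring_scope.
Local Open Scope quotient_scope.

Section Lspace_normedModType.
Context d (T : measurableType d) (R : realType).
Variables (mu : {measure set T -> \bar R}) (p : \bar R) (p1 : (1 <= p)%E).

Local Notation F := (LfunType mu p1).
Local Notation Lp := (LspaceType mu p1).
Local Notation M := {mfun T >-> measurableTypeR R}.
Local Notation Q := {mfun_ mu, T >-> measurableTypeR R}.

Lemma eq_ae_Lnorm (f g : T -> R) :
  measurable_fun setT f -> measurable_fun setT g -> f = g %[ae mu] ->
  Lnorm mu p (EFin \o f) = Lnorm mu p (EFin \o g).
Proof.
move=> mf mg fg; rewrite unlock; case: p p1 => [r r1|_|//].
- have mpow (h : T -> R) : measurable_fun setT h ->
      measurable_fun setT (fun x => (`|(EFin \o h) x| `^ r)%E).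
    move=> mh; apply/measurable_EFinP.
    apply: (@measurableT_comp _ _ _ _ _ _ (@powR R ^~ r)) => //.
    exact: measurableT_comp.
  congr (_ `^ _)%E; apply: ge0_ae_eq_integral => //.
  + exact: mpow.
  + exact: mpow.
  + by move=> x _; exact: poweR_ge0.
  + by move=> x _; exact: poweR_ge0.
  + by apply: filterS fg => x /(_ I) /= fgx _; rewrite fgx.
- case: ifPn => // _; apply: eq_ess_sup.
  by apply: filterS fg => x /(_ I) /= ->.
Qed.

(* LspaceType is built from functions into measurableTypeR R, LfunType from
   functions into R: same sigma-algebra, different displays. *)
Definition mfun_of_Lfun (f : F) : M :=
  HB.pack_for M (f : T -> measurableTypeR R)
    (isMeasurableFun.Build _ _ T (measurableTypeR R) f (measurable_funPT f)).

Lemma pi_ae (f : M) : ((\pi_Q f : Q) : T -> R) = f %[ae mu].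
Proof.
have /eqmodP/asboolP : repr (\pi_Q f) = f %[mod Q] by rewrite reprK.
by [].
Qed.

Lemma Lclass_finite (f : F) : finite_norm mu p (\pi_Q (mfun_of_Lfun f) : Q).
Proof.
rewrite /finite_norm (@eq_ae_Lnorm _ f).
- exact: Lfunction_finite.
- exact: (measurable_funPT (repr (\pi_Q (mfun_of_Lfun f)))).
- exact: (measurable_funPT f).
- exact: pi_ae.
Qed.

Definition Lclass (f : F) : Lp :=
  HB.pack_for Lp (\pi_Q (mfun_of_Lfun f) : Q)
    (isFinLebesgue.Build _ T R mu p p1 (\pi_Q (mfun_of_Lfun f)) (Lclass_finite f)).

Lemma Lrepr_measurable (u : Lp) : measurable_fun setT (u : T -> R).
Proof. exact: (measurable_funPT (repr (LebesgueSpace.sort u))). Qed.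

Lemma Lrepr_Lfun (u : Lp) : (u : T -> R) \in Lfun mu p.
Proof.
rewrite inE; apply/andP; split; rewrite inE /=; first exact: Lrepr_measurable.
exact: Lebesgue_finite.
Qed.

Definition Lrepr (u : Lp) : F := Lfun_Sub p1 (Lrepr_Lfun u).

Lemma Lclass_ae (f : F) : (Lclass f : T -> R) = f %[ae mu].
Proof. exact: pi_ae. Qed.

Lemma Lp_eqP (u v : Lp) : u = v <-> (u : T -> R) = v %[ae mu].
Proof.
split=> [->|uv]; first exact: ae_eq_refl.
case: u v uv => [u [[hu]]] [v [[hv]]] /= uv.
have e : u = v.
  rewrite -[u]reprK -[v]reprK; apply/eqmodP/asboolP; exact: uv.
by subst v; rewrite (Prop_irrelevance hu hv).
Qed.

Lemma LreprK : cancel Lrepr Lclass.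
Proof. by move=> u; apply/Lp_eqP; exact: Lclass_ae. Qed.

HB.instance Definition _ := Choice.copy Lp (can_type LreprK).

Definition Lp_zero : Lp := Lclass 0.
Definition Lp_opp (u : Lp) : Lp := Lclass (- Lrepr u).
Definition Lp_add (u v : Lp) : Lp := Lclass (Lrepr u + Lrepr v).
Definition Lp_scale (a : R) (u : Lp) : Lp := Lclass (a *: Lrepr u).

Lemma Lclass_eq (f g : F) : (f : T -> R) = g %[ae mu] <-> Lclass f = Lclass g.
Proof.
rewrite Lp_eqP; split=> h.
- apply: (ae_eq_trans (Lclass_ae f)); apply: (ae_eq_trans h).
  exact/ae_eq_sym/Lclass_ae.
- apply: (ae_eq_trans (ae_eq_sym (Lclass_ae f))); apply: (ae_eq_trans h).
  exact/Lclass_ae.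
Qed.

Lemma LclassD (f g : F) : Lp_add (Lclass f) (Lclass g) = Lclass (f + g).
Proof.
apply/Lclass_eq.
apply: filterS2 (Lclass_ae f) (Lclass_ae g) => x fx gx _.
exact: (congr2 +%R (fx I) (gx I)).
Qed.

Lemma LclassN (f : F) : Lp_opp (Lclass f) = Lclass (- f).
Proof.
apply/Lclass_eq; apply: filterS (Lclass_ae f) => x fx _.
exact: (congr1 -%R (fx I)).
Qed.

Lemma LclassZ a (f : F) : Lp_scale a (Lclass f) = Lclass (a *: f).
Proof.
apply/Lclass_eq; apply: filterS (Lclass_ae f) => x fx _.
exact: (congr1 ( *%R a) (fx I)).
Qed.

Let LP (P : Lp -> Prop) : (forall f, P (Lclass f)) -> forall u, P u.
Proof. by move=> h u; rewrite -[u]LreprK. Qed.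

Lemma Lp_addA : associative Lp_add.
Proof.
elim/LP => f; elim/LP => g; elim/LP => h.
by rewrite !LclassD addrA.
Qed.

Lemma Lp_addC : commutative Lp_add.
Proof. by elim/LP => f; elim/LP => g; rewrite !LclassD addrC. Qed.

Lemma Lp_add0 : left_id Lp_zero Lp_add.
Proof. by elim/LP => f; rewrite LclassD add0r. Qed.

Lemma Lp_addN : left_inverse Lp_zero Lp_opp Lp_add.
Proof. by elim/LP => f; rewrite LclassN LclassD addNr. Qed.

HB.instance Definition _ :=
  GRing.isZmodule.Build Lp Lp_addA Lp_addC Lp_add0 Lp_addN.

Lemma Lp_scaleA a b (u : Lp) : Lp_scale a (Lp_scale b u) = Lp_scale (a * b) u.
Proof. by elim/LP: u => f; rewrite !LclassZ scalerA. Qed.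

Lemma Lp_scale1 : left_id 1 Lp_scale.
Proof. by elim/LP => f; rewrite LclassZ scale1r. Qed.

Lemma Lp_scaleDr : right_distributive Lp_scale +%R.
Proof.
move=> a; elim/LP => f; elim/LP => g.
transitivity (Lp_scale a (Lp_add (Lclass f) (Lclass g))) => //.
by rewrite LclassD LclassZ scalerDr -LclassD -!LclassZ.
Qed.

Lemma Lp_scaleDl (u : Lp) : {morph Lp_scale^~ u : a b / a + b}.
Proof.
move=> a b; elim/LP: u => f.
by rewrite LclassZ scalerDl -LclassD -!LclassZ.
Qed.

HB.instance Definition _ := GRing.Zmodule_isLmodule.Build R Lp
  Lp_scaleA Lp_scale1 Lp_scaleDr Lp_scaleDl.

Definition Lp_norm (u : Lp) : R := fine (Lnorm mu p (EFin \o u)).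

Lemma Lp_normE (f : F) : Lp_norm (Lclass f) = fine (Lnorm mu p (EFin \o f)).
Proof.
congr fine; apply: eq_ae_Lnorm (Lclass_ae f).
- exact: Lrepr_measurable.
- exact: (measurable_funPT f).
Qed.

Lemma Lp_normD (u v : Lp) : Lp_norm (u + v) <= Lp_norm u + Lp_norm v.
Proof.
elim/LP: u => f; elim/LP: v => g.
have -> : Lclass f + Lclass g = Lclass (f + g) by exact: LclassD.
by rewrite !Lp_normE; exact: ler_LnormD.
Qed.

Lemma Lp_normZ (a : R) (u : Lp) : Lp_norm (a *: u) = `|a| * Lp_norm u.
Proof.
elim/LP: u => f.
have -> : a *: Lclass f = Lclass (a *: f) by exact: LclassZ.
rewrite !Lp_normE.
have := LnormZ f a.
rewrite -[EFin \o (a \*: f)]/(EFin \o (a *: f : F)) => ->.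
by rewrite -finite_norm_fine -EFinM.
Qed.

Lemma Lp_norm0_eq0 (u : Lp) : Lp_norm u = 0 -> u = 0.
Proof.
elim/LP: u => f; rewrite Lp_normE => /fine_Lnormr_eq0 f0.
by apply/Lclass_eq.
Qed.

HB.instance Definition _ :=
  Lmodule_isNormed.Build R Lp Lp_normD Lp_normZ Lp_norm0_eq0.

Lemma Lfun_normr (f : F) : (Num.norm \o f : T -> R) \in Lfun mu p.
Proof.
rewrite inE; apply/andP; split; rewrite inE /=.
  by apply: measurableT_comp => //; exact: (measurable_funPT f).
rewrite /finite_norm.
have -> : EFin \o (Num.norm \o f) = (abse \o (EFin \o f))%E by [].
by rewrite Lnorm_abse; exact: Lfunction_finite.
Qed.

Let Lfun_abs (f : F) : F := Lfun_Sub p1 (Lfun_normr f).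

Lemma Lfun_min (f g : F) : (f \min g : T -> R) \in Lfun mu p.
Proof.
have -> : (f \min g : T -> R) = (2^-1 *: (f + g - Lfun_abs (f - g)) : F).
  by apply/funext => x /=; rewrite minr_absE mulrC.
exact: LfunP.
Qed.

Lemma Lfun_max (f g : F) : (f \max g : T -> R) \in Lfun mu p.
Proof.
have -> : (f \max g : T -> R) = (2^-1 *: (f + g + Lfun_abs (f - g)) : F).
  by apply/funext => x /=; rewrite maxr_absE mulrC.
exact: LfunP.
Qed.

Definition Lp_le (u v : Lp) : Prop := \forall x \ae mu, u x <= v x.

Definition Lp_min (u v : Lp) : Lp :=
  Lclass (Lfun_Sub p1 (Lfun_min (Lrepr u) (Lrepr v))).

Definition Lp_max (u v : Lp) : Lp :=
  Lclass (Lfun_Sub p1 (Lfun_max (Lrepr u) (Lrepr v))).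

Lemma Lp_minE (u v : Lp) : \forall x \ae mu, Lp_min u v x = Num.min (u x) (v x).
Proof.
have := Lclass_ae (Lfun_Sub p1 (Lfun_min (Lrepr u) (Lrepr v))).
by apply: filterS => x /(_ I).
Qed.

Lemma Lp_maxE (u v : Lp) : \forall x \ae mu, Lp_max u v x = Num.max (u x) (v x).
Proof.
have := Lclass_ae (Lfun_Sub p1 (Lfun_max (Lrepr u) (Lrepr v))).
by apply: filterS => x /(_ I).
Qed.

End Lspace_normedModType.


Definition L2_dot d (T : measurableType d) (R : realType)
    (mu : {measure set T -> \bar R}) (u v : LspaceType2 mu) : R :=
  \int[mu]_x (u x * v x).

Lemma L2_dot_norm d (T : measurableType d) (R : realType)
    (mu : {measure set T -> \bar R}) (u : LspaceType2 mu) :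
  L2_dot u u = `|u| ^+ 2.
Proof.
have NE : (`|u|)%:E = Lnorm mu 2%:E (EFin \o u).
  apply: fineK; rewrite ge0_fin_numE; last exact: Lnorm_ge0.
  exact: (@Lebesgue_finite _ _ _ _ _ _ u).
have := @poweR_Lnorm _ _ _ mu (EFin \o u) 2.
rewrite pnatr_eq0 => /(_ isT).
rewrite -NE poweR_EFin powR_mulrn// => h.
rewrite -[RHS]/(fine (`|u| ^+ 2)%:E) h; congr fine; apply: eq_integral => x _ /=.
by rewrite powR_mulrn// real_normK ?num_real// expr2.
Qed.

(* The weak topology sigma(E, E'), as the supremum of the initial topologies of
   the continuous linear functionals. *)
Definition weak_type (R : realType) (E : tvsType R) : Type :=
  sup_topology (fun l : {l : {linear E -> R^o} | continuous l} =>
    Topological.class (initial_topology (sval l : E -> R^o))).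
HB.instance Definition _ (R : realType) (E : tvsType R) :=
  Topological.on (weak_type E).

Section functionals.
Context (R : realType) (V : tvsType R).
Implicit Types phi : V -> \bar R.
Local Open Scope ereal_scope.

(* Functionals V -> R `|` {+oo} are rendered as functions into \bar R that never
   take the value -oo; convexity uses the convention 0 * +oo = 0. *)
Definition effdom phi : set V := [set v | phi v < +oo].

Definition never_Ny phi := forall v, phi v != -oo.

Definition proper_functional phi := effdom phi !=set0.

Definition convex_functional phi := forall (x y : V) (t : R), (0 <= t <= 1)%R ->
  phi (t *: x + (1 - t) *: y)%R <= t%:E * phi x + (1 - t)%:E * phi y.

Definition lsc_functional phi := forall c : R, closed [set v | phi v <= c%:E].

Definition coercive phi := forall c : R,
  compact (closure ([set v | phi v <= c%:E] : set (weak_type V))).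

End functionals.

Section generation.
Context d (T : measurableType d) (R : realType) (mu : {measure set T -> \bar R}).
Local Notation H := (LspaceType2 mu).

Definition weakly_continuous (V : tvsType R) (j : V -> H) :=
  continuous (j : weak_type V -> weak_type H).

Definition elliptic (V : tvsType R) (j : V -> H) (phi : V -> \bar R) :=
  exists2 omega : R, 0 <= omega &
    let psi v := (phi v + (omega / 2 * `|j v| ^+ 2)%:E)%E in
    convex_functional psi /\ coercive psi.

(* The pairs (u, f) of the j-subgradient; phi v0 is finite in the difference
   quotient as soon as phi never takes the value -oo. *)
Definition jsubgrad (V : tvsType R) (j : V -> H) (phi : V -> \bar R) :
    set (H * H) :=
  [set uf | exists2 v0 : V, effdom phi v0 /\ j v0 = uf.1 &
    forall v : V,
      ((L2_dot uf.2 (j v))%:E <=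
       limf_einf (fun t : R => (phi (v0 + t *: v)%R - phi v0) * (t^-1)%:E)
                 (0 : R)^'+)%E].

Definition subgrad (psi : H -> \bar R) : set (H * H) := jsubgrad idfun psi.

Definition is_H_functional (V : tvsType R) (j : V -> H) (phi : V -> \bar R)
    (psi : H -> \bar R) :=
  [/\ never_Ny psi, convex_functional psi, proper_functional psi, lsc_functional psi &
      jsubgrad j phi `<=` subgrad psi].

(* Bochner measurability: g is a.e. on D the limit of simple functions. *)
Definition strongly_measurable (D : set R) (g : R -> H) :=
  exists s : nat -> R -> H,
    (forall n, finite_set (range (s n)) /\
               forall h, measurable (s n @^-1` [set h])) /\
    {ae lebesgue_measure, forall t : R, D t -> s n t @[n --> \oo] --> g t}.

Definition Linfty_loc (g : R -> H) :=
  strongly_measurable `]0, +oo[ g /\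
  forall a b : R, 0 < a -> a <= b -> exists M : R,
    {ae lebesgue_measure, forall t : R, a <= t <= b -> `|g t| <= M}.

(* u belongs to W^{1,oo}_loc((0,oo);H) with derivative g. The Bochner integral
   in u t - u s = \int_s^t g is tested against all h in H; since g is strongly
   measurable and essentially bounded on `[s, t], this determines it. *)
Definition W1infty_loc (u g : R -> H) :=
  Linfty_loc g /\
  forall (s t : R) (h : H), 0 < s -> s <= t ->
    L2_dot (u t - u s) h = \int[lebesgue_measure]_(r in `[s, t]) L2_dot (g r) h.

(* u' + d_j phi(u) \ni 0 a.e. on (0, oo), u 0 = u0 *)
Definition solution (V : tvsType R) (j : V -> H) (phi : V -> \bar R)
    (u0 : H) (u : R -> H) :=
  [/\ {within `[0, +oo[, continuous u}, u 0 = u0 &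
   exists2 u' : R -> H, W1infty_loc u u' &
     {ae lebesgue_measure, forall t : R, 0 < t -> jsubgrad j phi (u t, - u' t)}].

(* S t u0 is relevant for t >= 0 and u0 in the closure of j(D(phi)) only. *)
Definition generates (V : tvsType R) (j : V -> H) (phi : V -> \bar R)
    (S : R -> H -> H) :=
  forall u0, closure (j @` effdom phi) u0 -> solution j phi u0 (S ^~ u0).

Definition leaves_invariant (S : R -> H -> H) (C : set H) :=
  forall t : R, 0 <= t -> S t @` C `<=` C.

End generation.

(* Main.v *)
From HB Require Import structures.
Require Import Defs.
From mathcomp Require Import all_boot all_order all_algebra.
From mathcomp Require Import all_classical all_reals all_analysis.
From mathcomp Require Import measurable_realfun ring lra.

Set Implicit Arguments.
Unset Strict Implicit.
Unset Printing Implicit Defensive.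

Import Order.TTheory GRing.Theory Num.Theory.
Import numFieldNormedType.Exports.

Local Open Scope classical_set_scope.
Local Open Scope ring_scope.

(** Write A_i for the j_i-subgradient of phi_i. For k larger than the ellipticity
    constant, phi_i + k/2 |j_i . - p|^2 has weakly compact sublevels, hence a
    minimizer v; its image x = j_i v is the resolvent of p, and k (p - x) is an
    element of A_i x. The three assertions are compared through resolvents.

    The functional on H. The inclusion of A_i in the subgradient of phi_i^H makes
    x also the minimizer of phi_i^H + k/2 |. - p|^2. The Moreau envelopes of
    phi_i and phi_i^H thus have the same gradient k (p - x) and differ by a
    constant, which can be read off at any subgradient and so does not depend on
    k. As k tends to infinity, phi_i^H becomes the infimum of phi_i over the
    fibres of j_i up to a constant, and weak compactness of the sublevels shows
    that this infimum is attained (H_functionalE). This turns the inequality for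
    the functionals on H into the one for phi_1 and phi_2.

    From domination to the inequality on H. Domination means that the product
    semigroup leaves K = {(u, v) in C x C | u <= v} invariant. If x is the
    resolvent of a point p of K, then k (p - x) is a subgradient at x, so the
    semigroup started at a point z of K near the projection of x on K would
    approach x at a rate bounded below by the squared distance of x to K;
    invariance forces this distance to vanish (invariant_near_resolvent). So the
    resolvents of ordered points of C are ordered (resolvent_le). Let w be the
    positive part of u1 - u2. The segments from u1 /\ u2 to u1 and from u2 to
    u1 \/ u2 are both translations along w, and their starting points agree
    wherever w > 0. The order of the resolvents then compares the slopes of the
    two envelopes along these segments, and integration gives the inequality for
    the envelopes (envelope_lattice_inequality); k tends to infinity in
    penalized_sum_limit.

    From the inequality for phi_1 and phi_2 to domination. Inserted into the
    subgradient inequalities it reads <f1 - f2, (x1 - x2)^+> >= 0 for f_i in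
    A_i x_i and x_i in C, so half the squared norm of the positive part of
    S1(t) u - S2(t) v decreases in t (domination_of_lattice_inequality).

    Every integration along a path is a subdivision argument (increment_le): if
    f t - f s <= c (t - s) + K (t - s)^2 for all s <= t, then the quadratic term
    can be dropped. It serves for trajectories, for envelopes along segments and
    for the difference of two envelopes. *)

(** * Sublinear functionals and the Hahn-Banach theorem *)

Section sublinear.
Context (R : realType) (V : lmodType R).
Implicit Types p q : V -> R.

Definition sublinear p :=
  (forall x y, p (x + y) <= p x + p y) /\
  (forall (t : R) x, 0 <= t -> p (t *: x) = t * p x).

Lemma sublinear0 p : sublinear p -> p 0 = 0.
Proof. by case=> _ /(_ 0 0 (lexx _)); rewrite scaler0 mul0r. Qed.

Lemma sublinearN p x : sublinear p -> - p (- x) <= p x.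
Proof.
move=> sp; rewrite -subr_ge0 opprK addrC -(sublinear0 sp) -(subrr x).
by rewrite [leRHS]addrC; case: sp => + _; exact.
Qed.

Definition slope_set p y x := [set z | exists2 t : R, 0 <= t & z = p (x + t *: y) - t * p y].

(** A sublinear minorant of p that takes the value - p y at - y: it has been
    made linear in the direction y. *)
Definition sublinear_slope p y x := inf (slope_set p y x).

Lemma slope_set_lb p y x z : sublinear p -> slope_set p y x z -> - p (- x) <= z.
Proof.
move=> [pD pZ] [t t0 ->]; rewrite -(pZ _ _ t0).
have := pD (x + t *: y) (- x); rewrite addrAC subrr add0r; lra.
Qed.

Lemma slope_set_has_inf p y x : sublinear p -> has_inf (slope_set p y x).
Proof.
move=> sp; split; first by exists (p (x + 0 *: y) - 0 * p y), 0.
by exists (- p (- x)) => z; exact: slope_set_lb.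
Qed.

Lemma sublinear_slope_le p y x t : sublinear p -> 0 <= t ->
  sublinear_slope p y x <= p (x + t *: y) - t * p y.
Proof.
by move=> sp t0; apply: ge_inf; [case: (slope_set_has_inf y x sp)|exists t].
Qed.

Lemma sublinear_slope_ge p y x c : sublinear p ->
  (forall t, 0 <= t -> c <= p (x + t *: y) - t * p y) -> c <= sublinear_slope p y x.
Proof.
move=> sp h; apply: lb_le_inf; first by case: (slope_set_has_inf y x sp).
by move=> _ [t t0 ->]; exact: h.
Qed.

Lemma sublinear_sublinear_slope p y : sublinear p -> sublinear (sublinear_slope p y).
Proof.
move=> sp; have [pD pZ] := sp; split=> [x x'|s x].
  rewrite -lerBlDr; apply: sublinear_slope_ge => // t t0.
  rewrite lerBlDr -lerBlDl; apply: sublinear_slope_ge => // s s0.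
  rewrite lerBlDl.
  apply: (le_trans (sublinear_slope_le y (x + x') sp (addr_ge0 t0 s0))).
  have -> : x + x' + (t + s) *: y = (x + t *: y) + (x' + s *: y).
    by rewrite scalerDl addrACA.
  by have := pD (x + t *: y) (x' + s *: y); lra.
rewrite le_eqVlt => /predU1P[<-|s0].
  rewrite scale0r mul0r; apply/eqP; rewrite eq_le; apply/andP; split.
    have := sublinear_slope_le y 0 sp (lexx 0).
    by rewrite scale0r addr0 (sublinear0 sp) mul0r subr0.
  apply: sublinear_slope_ge => // t t0.
  by rewrite add0r (pZ _ _ t0) subrr.
apply/eqP; rewrite eq_le; apply/andP; split.
  rewrite mulrC -ler_pdivrMr//; apply: sublinear_slope_ge => // t t0.
  rewrite ler_pdivrMr//.
  have := sublinear_slope_le y (s *: x) sp (mulr_ge0 (ltW s0) t0).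
  rewrite -scalerA -scalerDr (pZ _ _ (ltW s0)).
  by move=> /le_trans; apply; rewrite le_eqVlt; apply/orP; left; apply/eqP; ring.
apply: sublinear_slope_ge => // t t0.
have st0 : 0 <= s^-1 * t by rewrite mulr_ge0// invr_ge0 ltW.
have := sublinear_slope_le y x sp st0.
rewrite -(ler_pM2l s0) mulrBr -(pZ _ _ (ltW s0)) scalerDr scalerA !mulrA.
by rewrite divff ?gt_eqF// mul1r.
Qed.

(** A minimal sublinear functional q is linear: it coincides with its slope in
    every direction y, and q x <= q (x + y) - q y is superadditivity. Zorn's
    lemma is applied below the slope of p in the direction x0, whose minorants l
    all satisfy l (- x0) <= - p x0. *)
Lemma hahn_banach p x0 : sublinear p ->
  exists l : {linear V -> R^o}, (forall x, l x <= p x) /\ l x0 = p x0.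
Proof.
move=> sp.

pose p0 := sublinear_slope p x0.
pose S := {q : V -> R | sublinear q /\ forall x, q x <= p0 x}.
have sp0 : sublinear p0 by exact: sublinear_sublinear_slope.
pose top : S := exist _ p0 (conj sp0 (fun x => lexx _)).
pose r (q q' : S) := `[< forall x, sval q' x <= sval q x >].
have [||q q'|A Atot|q qmin] := @Zorn S r.
- by move=> q; apply/asboolP.
- move=> q1 q2 q3 /asboolP h1 /asboolP h2; apply/asboolP => x.
  exact: le_trans (h2 x) (h1 x).
- move=> /asboolP h1 /asboolP h2.
  have e : sval q = sval q' by apply/funext => x; apply: le_anti; rewrite h1 h2.
  by case: q q' e h1 h2 => [q hq] [q' hq'] /= e _ _; subst q'; congr exist; exact: Prop_irrelevance.
- have [[qA AqA]|nA] := pselect (exists q : S, A q); last first.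
    by exists top => s As; case: nA; exists s.
  pose P x := [set z | exists2 q : S, A q & z = sval q x].
  have lbP x z : P x z -> - p0 (- x) <= z.
    case=> q Aq ->; have [sq qp] := svalP q.
    by apply: le_trans (sublinearN _ sq); rewrite lerN2.
  have infP x : has_inf (P x).
    by split; [exists (sval qA x), qA|exists (- p0 (- x)) => z; exact: lbP].
  pose m x := inf (P x).
  have mle (q : S) x : A q -> m x <= sval q x.
    by move=> Aq; apply: ge_inf; [case: (infP x)|exists q].
  have mge x c : (forall q : S, A q -> c <= sval q x) -> c <= m x.
    move=> h; apply: lb_le_inf; first by case: (infP x).
    by move=> _ [q Aq ->]; exact: h.
  have sm : sublinear m.
    split=> [x y|t x].
      rewrite -lerBlDr; apply: (mge) => q1 Aq1.
      rewrite lerBlDr -lerBlDl; apply: (mge) => q2 Aq2.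
      rewrite lerBlDl.
      have [/asboolP h|/asboolP h] := Atot _ _ Aq1 Aq2.
        have [[qD _] _] := svalP q2.
        apply: (le_trans (mle _ _ Aq2)); apply: (le_trans (qD _ _)).
        by rewrite lerD2r.
      have [[qD _] _] := svalP q1.
      apply: (le_trans (mle _ _ Aq1)); apply: (le_trans (qD _ _)).
      by rewrite lerD2l.
    rewrite le_eqVlt => /predU1P[<-|t0].
      rewrite scale0r mul0r; apply/eqP; rewrite eq_le; apply/andP; split.
        by apply: le_trans (mle _ _ AqA) _; rewrite sublinear0//; case: (svalP qA).
      by apply: (mge) => q Aq; rewrite sublinear0//; case: (svalP q).
    apply/eqP; rewrite eq_le; apply/andP; split.
      rewrite mulrC -ler_pdivrMr//; apply: (mge) => q Aq.
      rewrite ler_pdivrMr// mulrC.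
      by have [[_ qZ] _] := svalP q; rewrite -(qZ _ _ (ltW t0)); exact: (mle).
    apply: (mge) => q Aq; have [[_ qZ] _] := svalP q; rewrite (qZ _ _ (ltW t0)).
    by rewrite ler_pM2l//; exact: (mle).
  have mp x : m x <= p0 x.
    by apply: le_trans (mle _ _ AqA) _; have [_] := svalP qA; exact.
  by exists (exist _ m (conj sm mp)) => s As; apply/asboolP => x /=; exact: (mle).
have [[qD qZ] qp] := svalP q.
have qs : sublinear (sval q) by split.
have qge x y : sval q x + sval q y <= sval q (x + y).
  have sq := sublinear_sublinear_slope y qs.
  have ql z : sublinear_slope (sval q) y z <= sval q z.
    by have := sublinear_slope_le y z qs (lexx 0); rewrite scale0r addr0 mul0r subr0.
  (* minimality of q against its slope in the direction y *)
  pose q' : S := exist _ (sublinear_slope (sval q) y)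
     (conj sq (fun z => le_trans (ql z) (qp z))).
  have /qmin e : r q q' by apply/asboolP.
  have := sublinear_slope_le y x qs ler01.
  have -> : sublinear_slope (sval q) y x = sval q x by rewrite -[in RHS]e.
  by rewrite scale1r mul1r lerBrDr.
have addq x y : sval q (x + y) = sval q x + sval q y.
  by apply: le_anti; rewrite qD qge.
have q0 : sval q 0 = 0 by exact: sublinear0.
have qN x : sval q (- x) = - sval q x.
  by apply/eqP; rewrite -addr_eq0 -addq addNr q0.
have linq : linear (sval q : V -> R^o).
  move=> a x y; rewrite addq; congr (_ + _).
  have [a0|a0] := leP 0 a; first by rewrite qZ.
  by rewrite -[a]opprK scaleNr qN qZ ?oppr_ge0 ?ltW// scaleNr.
pose lM := GRing.isLinear.Build R V R^o *:%R (sval q) linq.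
pose l : {linear V -> R^o} := HB.pack (sval q : V -> R^o) lM.
exists l; split=> [x|].
  apply: (le_trans (qp x)).
  by have := sublinear_slope_le x0 x sp (lexx 0); rewrite scale0r addr0 mul0r subr0.
apply: le_anti; apply/andP; split.
  apply: (le_trans (qp x0)).
  by have := sublinear_slope_le x0 x0 sp (lexx 0); rewrite scale0r addr0 mul0r subr0.
rewrite -[leRHS]opprK -lerN2 opprK.
rewrite -[- sval q x0]/(- (sval q x0)) -qN.
apply: (le_trans (qp _)).
have := sublinear_slope_le x0 (- x0) sp ler01.
by rewrite scale1r mul1r addNr sublinear0// add0r.
Qed.

End sublinear.

(** * Closed convex sets are weakly closed *)

Section weak_topology.
Context (R : realType) (V : tvsType R).

Lemma weak_continuous (l : {linear V -> R^o}) : continuous l ->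
  continuous (l : weak_type V -> R^o).
Proof.
move=> lc v.
pose i : {l : {linear V -> R^o} | continuous l} := exist _ l lc.
have : nbhs (v : weak_type V) --> (v : initial_topology (l : V -> R^o)).
  by have /cvg_sup /(_ i) : nbhs (v : weak_type V) --> (v : weak_type V) by [].
by move=> h A /(@initial_continuous _ _ (l : V -> R^o) v)/h.
Qed.

Lemma id_weak_continuous : continuous (id : V -> weak_type V).
Proof.
move=> v; apply/cvg_sup => -[l lc] /=.
move=> A /= [_ [[B Bo <-] Bv BA]].
by apply: filterS BA _; apply: lc; exact: open_nbhs_nbhs.
Qed.

Lemma convex_setE (A : set V) : convex_set A <->
  forall x y (t : R), A x -> A y -> 0 <= t <= 1 -> A (t *: x + (1 - t) *: y).
Proof.
split=> [cA x y t Ax Ay /andP[t0 t1]|cA x y l /set_mem Ax /set_mem Ay].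
  have := cA x y (Itv01 t0 t1) (mem_set Ax) (mem_set Ay).
  by move/set_mem.
by apply/mem_set; apply: cA => //; apply/andP; split.
Qed.

End weak_topology.

Section gauge.
Context (R : realType) (V : lmodType R) (G : set V).
Hypothesis G_convex : forall x y (t : R), G x -> G y -> 0 <= t <= 1 ->
  G (t *: x + (1 - t) *: y).
Hypothesis G_absorbing : forall x, exists2 t : R, 0 < t & G (t^-1 *: x).

Definition gauge_set x := [set t : R | 0 < t /\ G (t^-1 *: x)].
Definition gauge x := inf (gauge_set x).

Let gauge_lb x : lbound (gauge_set x) 0.
Proof. by move=> t [/ltW]. Qed.

Let gauge_has_inf x : has_inf (gauge_set x).
Proof. by have [t t0 Gt] := G_absorbing x; split; [exists t|exists 0]. Qed.

Lemma gauge_le x t : 0 < t -> G (t^-1 *: x) -> gauge x <= t.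
Proof. by move=> t0 Gt; apply: ge_inf => //; exists 0. Qed.

Lemma gauge_ge x c : (forall t, 0 < t -> G (t^-1 *: x) -> c <= t) -> c <= gauge x.
Proof.
move=> h; apply: lb_le_inf; first by have [] := gauge_has_inf x.
by move=> t [t0 Gt]; exact: h.
Qed.

Lemma sublinear_gauge : sublinear gauge.
Proof.
split=> [x y|t x].
  rewrite -lerBlDr; apply: gauge_ge => t t0 Gt.
  rewrite lerBlDr -lerBlDl; apply: gauge_ge => s s0 Gs.
  rewrite lerBlDl; apply: gauge_le; first exact: addr_gt0.
  have ts0 : t + s != 0 by rewrite gt_eqF// addr_gt0.
  have -> : (t + s)^-1 *: (x + y) =
      (t / (t + s)) *: (t^-1 *: x) + (1 - t / (t + s)) *: (s^-1 *: y).
    rewrite scalerDr !scalerA; congr (_ *: _ + _ *: _); field.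
      by rewrite ts0 gt_eqF.
    by rewrite ts0 gt_eqF.
  apply: G_convex => //; apply/andP; split.
    by rewrite divr_ge0// ltW// addr_gt0.
  by rewrite ler_pdivrMr ?addr_gt0// mul1r lerDl ltW.
have gz z : 0 <= gauge z by apply: gauge_ge => ? /ltW.
have le_t s z : 0 < s -> gauge (s *: z) <= s * gauge z.
  move=> s0; rewrite mulrC -ler_pdivrMr//; apply: gauge_ge => r r0 Gr.
  rewrite ler_pdivrMr//; apply: gauge_le; first exact: mulr_gt0.
  by rewrite scalerA invfM -mulrA mulVf ?gt_eqF// mulr1.
rewrite le_eqVlt => /predU1P[<-|t0].
  rewrite scale0r mul0r; apply: le_anti; rewrite gz andbT.
  have [s s0 Gs] := G_absorbing 0; rewrite scaler0 in Gs.
  rewrite -[leRHS]addr0; apply/ler_addgt0Pr => e e0.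
  by rewrite addr0 add0r; apply: gauge_le => //; rewrite scaler0.
apply: le_anti; rewrite le_t//=.
rewrite -ler_pdivlMl//.
have := le_t t^-1 (t *: x); rewrite invr_gt0 => /(_ t0).
by rewrite scalerA mulVf ?gt_eqF// scale1r.
Qed.

End gauge.

Section mazur.
Context (R : realType) (V : tvsType R).

Lemma nbhs0_absorbing (U : set V) x : nbhs 0 U ->
  exists2 t : R, 0 < t & U (t *: x).
Proof.
move=> U0.
have /= := @scale_continuous R V ((0 : R^o), x) U.
rewrite scale0r => /(_ U0)[[B1 B2]/= [/nbhs_ballP[e /= e0 eB] B2x] BU].
exists (e / 2); first by rewrite divr_gt0.
apply: (BU (e / 2, x)); split => /=; last exact: nbhs_singleton.
apply: eB; rewrite /ball/= sub0r normrN gtr0_norm ?divr_gt0//.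
by rewrite ltr_pdivrMr// ltr_pMr// ltr1n.
Qed.

Lemma linear_bounded_continuous (l : {linear V -> R^o}) (U : set V) :
  nbhs 0 U -> (forall x, U x -> l x <= 1) -> continuous l.
Proof.
move=> U0 lU x; apply/cvgrPdist_le => e e0.
pose W := U `&` (-%R @` U).
have W0 : nbhs 0 W by apply: filterI => //; exact: nbhs0N.
have eW : nbhs 0 ( *:%R e @` W) by apply: nbhs0Z => //; rewrite gt_eqF.
have := nbhsT x eW; apply: filterS => _ [_ [w [Uw [w' Uw' ww']] <-] <-].
rewrite linearD linearZ opprD addNKr normrN.
rewrite normrM (gtr0_norm e0) -[leRHS]mulr1 ler_pM2l//.
rewrite ler_norml lU// andbT lerNl -linearN.
by apply: lU; rewrite -ww' opprK.
Qed.

(** With U a convex neighbourhood of 0 such that v - U misses A, the convex set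
    G = U + A - a0 is absorbing and does not contain v - a0. A linear functional
    below the gauge of G, equal to it at v - a0, is at most 1 on G and at least 1
    at v - a0; a small multiple of v - a0 lies in U and makes the separation
    strict. *)
Lemma separation (A : set V) v : closed A -> convex_set A -> A !=set0 -> ~ A v ->
  exists (l : {linear V -> R^o}) (c : R), [/\ continuous l, c < l v & forall a, A a -> l a <= c].
Proof.
move=> Acl /convex_setE Acv [a0 Aa0] nAv.

have [U [U0 Ucv UA]] : exists U : set V, [/\ nbhs 0 U,
    (forall x y (t : R), U x -> U y -> 0 <= t <= 1 -> U (t *: x + (1 - t) *: y)) &
    forall u, U u -> ~ A (v - u)].
  have c (B : set V) : nbhs v B -> nbhs 0 [set u | B (v - u)].
    have /= := @sub_continuous V (v, 0) B; rewrite subr0 => + vB => /(_ vB).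
    move=> [[B1 B2]/= [B1v B20] BU]; apply: filterS B20 => u B2u.
    by apply: (BU (v, u)); split => //=; exact: nbhs_singleton.
  have /c nA : nbhs v (~` A) by apply: open_nbhs_nbhs; split => //; exact: closed_openC.
  have [B Bcv [Bo Bb]] := @locally_convex R V.
  have [W [BW W0] WA] := Bb 0 _ nA.
  exists W; split=> //.
    by apply: open_nbhs_nbhs; split => //; exact: Bo.
  exact/convex_setE/Bcv/mem_set.
pose G := [set z | exists2 u, U u & exists2 a, A a & z = u + (a - a0)].
have UG u : U u -> G u by move=> Uu; exists u => //; exists a0 => //; rewrite subrr addr0.
have Gcv x y (t : R) : G x -> G y -> 0 <= t <= 1 -> G (t *: x + (1 - t) *: y).
  move=> [u Uu [a Aa ->]] [u' Uu' [a' Aa' ->]] t01.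
  exists (t *: u + (1 - t) *: u'); first exact: Ucv.
  exists (t *: a + (1 - t) *: a'); first exact: Acv.
  rewrite !scalerDr addrACA; congr (_ + _).
  by rewrite addrACA -scalerDl addrCA subrr addr0 scale1r.
have Gab x : exists2 t : R, 0 < t & G (t^-1 *: x).
  have [t t0 Ut] := nbhs0_absorbing x U0.
  by exists t^-1; rewrite ?invr_gt0// invrK; exact: UG.
have G0 : G 0 by apply: UG; exact: nbhs_singleton.
have nGx : ~ G (v - a0).
  move=> [u Uu [a Aa]] /eqP; rewrite addrA subr_eq subrK => /eqP e.
  by apply: (UA u Uu); rewrite e addrAC subrr add0r.
have [l [lp lx]] := hahn_banach (v - a0) (sublinear_gauge Gcv Gab).
have lG z : G z -> l z <= 1.
  by move=> Gz; apply: (le_trans (lp z)); apply: gauge_le => //; rewrite invr1 scale1r.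
have lx1 : 1 <= l (v - a0).
  rewrite lx; apply: gauge_ge => // t t0 Gt; rewrite leNgt; apply/negP => t1.
  apply: nGx; have := Gcv _ _ t Gt G0.
  rewrite (ltW t0) (ltW t1) => /(_ isT).
  by rewrite scaler0 addr0 scalerA divff ?gt_eqF// scale1r.
have [e e0 Ue] := nbhs0_absorbing (v - a0) U0.
exists l, (l v - e); split.
- by apply: (@linear_bounded_continuous l U) => // u /UG/lG.
- by rewrite gtrBl.
- move=> a Aa; have : l (e *: (v - a0) + (a - a0)) <= 1.
    by apply: lG; exists (e *: (v - a0)) => //; exists a.
  rewrite linearD linearZ /= => h.
  have h2 : e * 1 <= e * l (v - a0) by rewrite ler_pM2l.
  move: h h2 lx1; rewrite /GRing.scale/= !linearB; lra.
Qed.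

(** Mazur's theorem: the open half-spaces given by separation are weakly open. *)
Lemma closed_convex_weakly_closed (A : set V) : closed A -> convex_set A ->
  closed (A : set (weak_type V)).
Proof.
move=> Acl Acv; rewrite -[A]setCK; apply: open_closedC.
rewrite openE => v /= nAv; have [->|/set0P A0] := eqVneq A set0.
  by rewrite setC0; exact: filterT.
have [l [c [lc cv cA]]] := separation Acl Acv A0 nAv.
have : nbhs (v : weak_type V) (l @^-1` [set y | c < y]).
  by apply: (weak_continuous lc); apply: open_nbhs_nbhs; split => //; exact: open_gt.
by apply: filterS => w /= cw Aw; have := cA w Aw; rewrite leNgt cw.
Qed.

End mazur.

(** * The inner product and the order of L2 *)

Section L2.
Context d (T : measurableType d) (R : realType) (mu : {measure set T -> \bar R}).
Local Notation H := (LspaceType2 mu).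
Local Notation dot := (@L2_dot d T R mu).
Implicit Types (u v w : H) (a : R).

Lemma L2_add_ae u v : \forall x \ae mu, (u + v) x = u x + v x.
Proof.
have := Lclass_ae (Lrepr u + Lrepr v).
by apply: filterS => x /(_ I).
Qed.

Lemma L2_scale_ae a u : \forall x \ae mu, (a *: u) x = a * u x.
Proof.
have := Lclass_ae (a *: Lrepr u).
by apply: filterS => x /(_ I).
Qed.

Lemma L2_zero_ae : \forall x \ae mu, (0 : H) x = 0.
Proof.
have := Lclass_ae (0 : LfunType mu (lee1n 2)).
by apply: filterS => x /(_ I).
Qed.

Lemma L2_opp_ae u : \forall x \ae mu, (- u) x = - u x.
Proof.
have := Lclass_ae (- Lrepr u).
by apply: filterS => x /(_ I).
Qed.

Lemma L2_mul_integrable u v : mu.-integrable setT (EFin \o (fun x => u x * v x)).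
Proof. by apply/Lfun1_integrable/Lfun2_mul_Lfun1; exact: Lrepr_Lfun. Qed.

Lemma ae_eq_Rintegral (f g : T -> R) :
  mu.-integrable setT (EFin \o f) -> mu.-integrable setT (EFin \o g) ->
  (\forall x \ae mu, f x = g x) -> \int[mu]_x f x = \int[mu]_x g x.
Proof.
move=> /integrableP[mf _] /integrableP[mg _] fg.
congr fine; apply: ae_eq_integral => //.
by apply: filterS fg => x + _ => /= ->.
Qed.

Lemma dotC u v : dot u v = dot v u.
Proof. by apply: eq_Rintegral => x _; rewrite mulrC. Qed.

Lemma dotDl u v w : dot (u + v) w = dot u w + dot v w.
Proof.
rewrite /L2_dot -RintegralD//; try exact: L2_mul_integrable.
apply: ae_eq_Rintegral; first exact: L2_mul_integrable.
  exact: (integrableD measurableT (L2_mul_integrable u w) (L2_mul_integrable v w)).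
by apply: filterS (L2_add_ae u v) => x ->; rewrite mulrDl.
Qed.

Lemma dotZl a u w : dot (a *: u) w = a * dot u w.
Proof.
rewrite /L2_dot -RintegralZl//; try exact: L2_mul_integrable.
apply: ae_eq_Rintegral; first exact: L2_mul_integrable.
  exact: (integrableZl measurableT a (L2_mul_integrable u w)).
by apply: filterS (L2_scale_ae a u) => x ->; rewrite mulrA.
Qed.

Lemma dotNl u w : dot (- u) w = - dot u w.
Proof. by rewrite -scaleN1r dotZl mulN1r. Qed.

Lemma dotBl u v w : dot (u - v) w = dot u w - dot v w.
Proof. by rewrite dotDl dotNl. Qed.

Lemma dotDr u v w : dot w (u + v) = dot w u + dot w v.
Proof. by rewrite dotC dotDl !(dotC w). Qed.

Lemma dotZr a u w : dot w (a *: u) = a * dot w u.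
Proof. by rewrite dotC dotZl !(dotC w). Qed.

Lemma dotNr u w : dot w (- u) = - dot w u.
Proof. by rewrite dotC dotNl !(dotC w). Qed.

Lemma dotBr u v w : dot w (u - v) = dot w u - dot w v.
Proof. by rewrite dotDr dotNr. Qed.

Lemma dot0l w : dot 0 w = 0.
Proof. by rewrite -(scale0r 0) dotZl mul0r. Qed.

Lemma dot0r w : dot w 0 = 0.
Proof. by rewrite dotC dot0l. Qed.

Definition dotE := (dotDl, dotDr, dotBl, dotBr, dotNl, dotNr, dotZl, dotZr).

Lemma dot_ge0 u : 0 <= dot u u.
Proof. by rewrite L2_dot_norm sqr_ge0. Qed.

Lemma cauchy_schwarz u v : dot u v <= `|u| * `|v|.
Proof.
have [->|u0] := eqVneq u 0; first by rewrite dot0l normr0 mul0r.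
have [->|v0] := eqVneq v 0; first by rewrite dot0r normr0 mulr0.
have nu : 0 < `|u| by rewrite normr_gt0.
have nv : 0 < `|v| by rewrite normr_gt0.
have := dot_ge0 (`|v| *: u - `|u| *: v).
rewrite !dotE (dotC v u) (L2_dot_norm u) (L2_dot_norm v) => h.
rewrite -subr_ge0 -(pmulr_lge0 _ (mulr_gt0 nu nv)).
rewrite -(@pmulr_rge0 _ 2)//; apply: (le_trans h).
by rewrite le_eqVlt; apply/orP; left; apply/eqP; ring.
Qed.

Lemma cauchy_schwarz_abs u v : `|dot u v| <= `|u| * `|v|.
Proof.
rewrite ler_norml cauchy_schwarz andbT lerNl -dotNl.
by rewrite -(normrN u) cauchy_schwarz.
Qed.

Lemma norm_midpoint (a b c : H) : `|b - a| ^+ 2 =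
  2 * `|a - c| ^+ 2 + 2 * `|b - c| ^+ 2 - 4 * `|2^-1 *: a + (1 - 2^-1) *: b - c| ^+ 2.
Proof.
have -> : 1 - 2^-1 = (2^-1 : R) by lra.
by rewrite -!L2_dot_norm !dotE (dotC b a) (dotC c a) (dotC c b); field.
Qed.

Lemma norm_segment (t : R) (a b c : H) : `|t *: a + (1 - t) *: b - c| ^+ 2 =
  `|b - c| ^+ 2 - 2 * t * dot (a - b) (c - b) + t ^+ 2 * `|a - b| ^+ 2.
Proof.
by rewrite -!L2_dot_norm !dotE (dotC b a) (dotC c a) (dotC c b); ring.
Qed.

Lemma sqr_norm_triangle (a b c : H) :
  `|a - b| ^+ 2 <= 2 * `|a - c| ^+ 2 + 2 * `|b - c| ^+ 2.
Proof.
have := sqr_ge0 `|2^-1 *: a + (1 - 2^-1) *: b - c|; have := norm_midpoint a b c.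
rewrite (distrC b a); lra.
Qed.

Lemma dot_subr_split (a b c : H) :
  dot (a - b) (b - c) = dot (a - c) (b - c) - `|c - b| ^+ 2.
Proof.
by rewrite -L2_dot_norm !dotE (dotC c b); ring.
Qed.

Lemma sqr_norm_increment (x y : H) :
  2^-1 * `|y| ^+ 2 - 2^-1 * `|x| ^+ 2 <= dot y (y - x).
Proof.
by have := dot_ge0 (y - x); rewrite !dotE (dotC y x) !L2_dot_norm; lra.
Qed.

Lemma nbhs_normP u (A : set H) :
  nbhs u A <-> exists2 e : R, 0 < e & forall v, `|u - v| < e -> A v.
Proof.
split=> [/nbhs_ballP[e /= e0 eA]|[e e0 eA]].
  by exists e => // v uv; apply: eA; rewrite -ball_normE.
by apply/nbhs_ballP; exists e => // v; rewrite -ball_normE; exact: eA.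
Qed.

Lemma dot_continuous w : continuous (dot w : H -> R^o).
Proof.
move=> u B /nbhs_ballP[e /= e0 eB]; apply/nbhs_normP.
have w1 : 0 < `|w| + 1 by rewrite ltr_wpDl.
exists (e / (`|w| + 1)); first by rewrite divr_gt0.
move=> v uv; apply: eB; rewrite /ball/= -dotBr.
apply: (le_lt_trans (cauchy_schwarz_abs _ _)).
apply: (@le_lt_trans _ _ ((`|w| + 1) * `|u - v|)); first by rewrite ler_wpM2r// lerDl.
by rewrite mulrC -ltr_pdivlMr.
Qed.

Lemma dot_linear w : linear (dot w : H -> R^o).
Proof. by move=> a u v; rewrite dotDr dotZr. Qed.

HB.instance Definition _ w := GRing.isLinear.Build R H R^o *:%R (dot w) (dot_linear w).

Definition Lp_pos u : H := Lp_max u 0.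

Lemma Lp_pos_ae u : \forall x \ae mu, Lp_pos u x = Num.max (u x) 0.
Proof. by apply: filterS2 (Lp_maxE u 0) L2_zero_ae => x -> ->. Qed.

Lemma L2_eq_ae u v : (\forall x \ae mu, u x = v x) -> u = v.
Proof. by move=> uv; apply/Lp_eqP; apply: filterS uv => x ->. Qed.

Lemma Lp_maxB u v : Lp_max u v - v = Lp_pos (u - v).
Proof.
apply: L2_eq_ae; near=> x.
have -> : (Lp_max u v - v) x = Lp_max u v x + (- v) x by near: x; exact: L2_add_ae.
have -> : Lp_pos (u - v) x = Num.max ((u - v) x) 0 by near: x; exact: Lp_pos_ae.
have -> : (u - v) x = u x + (- v) x by near: x; exact: L2_add_ae.
have -> : (- v) x = - v x by near: x; exact: L2_opp_ae.
have -> : Lp_max u v x = Num.max (u x) (v x) by near: x; exact: Lp_maxE.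
by rewrite !maxEle; case: ifP; case: ifP; lra.
Unshelve. all: by end_near. Qed.

Lemma Lp_minB u v : u - Lp_min u v = Lp_pos (u - v).
Proof.
apply: L2_eq_ae; near=> x.
have -> : (u - Lp_min u v) x = u x + (- Lp_min u v) x by near: x; exact: L2_add_ae.
have -> : (- Lp_min u v) x = - Lp_min u v x by near: x; exact: L2_opp_ae.
have -> : Lp_min u v x = Num.min (u x) (v x) by near: x; exact: Lp_minE.
have -> : Lp_pos (u - v) x = Num.max ((u - v) x) 0 by near: x; exact: Lp_pos_ae.
have -> : (u - v) x = u x + (- v) x by near: x; exact: L2_add_ae.
have -> : (- v) x = - v x by near: x; exact: L2_opp_ae.
by rewrite minEle !maxEle; case: ifP; case: ifP; lra.
Unshelve. all: by end_near. Qed.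

Lemma Lp_leP u v : Lp_le u v <-> Lp_pos (u - v) = 0.
Proof.
have h : \forall x \ae mu, Lp_pos (u - v) x = Num.max (u x - v x) 0.
  near=> x.
  have -> : Lp_pos (u - v) x = Num.max ((u - v) x) 0 by near: x; exact: Lp_pos_ae.
  have -> : (u - v) x = u x + (- v) x by near: x; exact: L2_add_ae.
  by have -> : (- v) x = - v x by near: x; exact: L2_opp_ae.
split=> [uv|e].
  apply: L2_eq_ae; apply: filterS3 uv h L2_zero_ae => x uv -> ->.
  by rewrite maxEle subr_le0 uv.
rewrite e in h; apply: filterS2 h L2_zero_ae => x -> /eqP.
by rewrite maxEle; case: ifP => [|_ /eqP]; lra.
Unshelve. all: by end_near. Qed.

Lemma dot_ae_ge0 u v : (\forall x \ae mu, 0 <= u x * v x) -> 0 <= dot u v.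
Proof.
move=> uv.
have -> : dot u v = \int[mu]_x `|u x * v x|.
  apply: ae_eq_Rintegral; first exact: L2_mul_integrable.
    exact: (integrable_norm (L2_mul_integrable u v)).
  by apply: filterS uv => x /ger0_norm ->.
by apply: Rintegral_ge0 => x _.
Qed.

(** The positive part is the projection on the cone of nonnegative functions;
    this inequality and the next one are its variational characterization. *)
Lemma dot_pos_le u v : dot (Lp_pos u) v <= dot (Lp_pos u) (Lp_pos v).
Proof.
rewrite -subr_ge0 -dotBr; apply: dot_ae_ge0; near=> x.
have -> : (Lp_pos v - v) x = Lp_pos v x + (- v) x by near: x; exact: L2_add_ae.
have -> : (- v) x = - v x by near: x; exact: L2_opp_ae.
have -> : Lp_pos v x = Num.max (v x) 0 by near: x; exact: Lp_pos_ae.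
have -> : Lp_pos u x = Num.max (u x) 0 by near: x; exact: Lp_pos_ae.
by rewrite mulr_ge0 ?subr_ge0 ?le_max ?lexx ?orbT.
Unshelve. all: by end_near. Qed.

Lemma dot_posl u : dot (Lp_pos u) u = dot (Lp_pos u) (Lp_pos u).
Proof.
apply: ae_eq_Rintegral; try exact: L2_mul_integrable.
apply: filterS (Lp_pos_ae u) => x ->.
by rewrite maxEle; case: ifP; rewrite ?mul0r.
Qed.

Lemma Lp_pos_lip u v : `|Lp_pos u - Lp_pos v| <= `|u - v|.
Proof.
have h : `|Lp_pos u - Lp_pos v| ^+ 2 <= dot (Lp_pos u - Lp_pos v) (u - v).
  rewrite -L2_dot_norm !dotE (dotC (Lp_pos v) (Lp_pos u)) !dot_posl.
  by have := dot_pos_le u v; have := dot_pos_le v u; rewrite (dotC (Lp_pos v) (Lp_pos u)); lra.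
have := le_trans h (cauchy_schwarz _ _); rewrite expr2.
have [->|n0] := eqVneq (Lp_pos u - Lp_pos v) 0; first by rewrite normr0.
by rewrite ler_pM2l// normr_gt0.
Qed.

(** Half the squared norm of the positive part is convex, with gradient the
    positive part. *)
Lemma Lp_pos_increment (x y : H) :
  2^-1 * `|Lp_pos y| ^+ 2 - 2^-1 * `|Lp_pos x| ^+ 2 <= dot (Lp_pos y) (y - x).
Proof.
have := sqr_norm_increment (Lp_pos x) (Lp_pos y).
have := dot_pos_le y x.
rewrite !dotBr dot_posl; lra.
Qed.

Lemma Lp_min_subpos u v : Lp_min u v = u - Lp_pos (u - v).
Proof. by rewrite -Lp_minB opprB addrC subrK. Qed.

Lemma Lp_max_addpos u v : Lp_max u v = v + Lp_pos (u - v).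
Proof. by rewrite -Lp_maxB addrC subrK. Qed.

Lemma Lp_min_le u v : Lp_le (Lp_min u v) v.
Proof. by apply: filterS (Lp_minE u v) => x ->; rewrite ge_min lexx orbT. Qed.

Lemma Lp_le_convex u v u' v' (t : R) : Lp_le u v -> Lp_le u' v' -> 0 <= t <= 1 ->
  Lp_le (t *: u + (1 - t) *: u') (t *: v + (1 - t) *: v').
Proof.
move=> uv uv' /andP[t0 t1]; rewrite /Lp_le; near=> x.
have -> : (t *: u + (1 - t) *: u') x = (t *: u) x + ((1 - t) *: u') x by near: x; exact: L2_add_ae.
have -> : (t *: v + (1 - t) *: v') x = (t *: v) x + ((1 - t) *: v') x by near: x; exact: L2_add_ae.
have -> : (t *: u) x = t * u x by near: x; exact: L2_scale_ae.
have -> : (t *: v) x = t * v x by near: x; exact: L2_scale_ae.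
have -> : ((1 - t) *: u') x = (1 - t) * u' x by near: x; exact: L2_scale_ae.
have -> : ((1 - t) *: v') x = (1 - t) * v' x by near: x; exact: L2_scale_ae.
apply: lerD; rewrite ler_wpM2l ?subr_ge0//; near: x; [exact: uv|exact: uv'].
Unshelve. all: by end_near. Qed.

Lemma Lp_le_closed u v : (forall e : R, 0 < e -> exists u' v',
    Lp_le u' v' /\ `|u' - u| ^+ 2 + `|v' - v| ^+ 2 < e) -> Lp_le u v.
Proof.
move=> h; apply/Lp_leP/eqP; rewrite -normr_eq0 -sqrf_eq0 eq_le sqr_ge0 andbT.
apply/ler_addgt0Pr => e e0; rewrite add0r.
have e20 : 0 < e / 2 by rewrite divr_gt0.
have [u' [v' [/Lp_leP p0 he]]] := h _ e20.
have := Lp_pos_lip (u - v) (u' - v'); rewrite p0 subr0 -ler_sqr ?nnegrE//.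
move=> /le_trans; apply.
have -> : u - v - (u' - v') = (u - u') - (v - v').
  by rewrite !opprB addrACA [RHS]addrACA (addrC (- v)).
have := sqr_norm_triangle (u - u') (v - v') 0; rewrite !subr0 (distrC u) (distrC v).
by move: he; lra.
Qed.

End L2.

(** * Increments along trajectories *)

Section subdivision.
Context (R : realType).

(** Over a subdivision of [a, b] into n equal pieces the quadratic errors add up
    to K (b - a)^2 / n. *)
Lemma increment_le (f : R -> R) (a b c K : R) : a <= b -> 0 <= K ->
  (forall s t, a <= s -> s <= t -> t <= b ->
     f t - f s <= c * (t - s) + K * (t - s) ^+ 2) ->
  f b - f a <= c * (b - a).
Proof.
move=> ab K0 h; apply/ler_addgt0Pr => e e0.
have [n ne] : exists n : nat, K * (b - a) ^+ 2 / n.+1%:R <= e.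
  have X0 : 0 <= K * (b - a) ^+ 2 by rewrite mulr_ge0 ?sqr_ge0.
  set X := K * (b - a) ^+ 2 in X0 *; exists (Num.truncn (X / e)).
  rewrite ler_pdivrMr// mulrC -ler_pdivrMr//.
  by apply/ltW/truncnS_gt.
pose step := (b - a) / n.+1%:R.
have step0 : 0 <= step by rewrite divr_ge0 ?subr_ge0.
have nstep : n.+1%:R * step = b - a by rewrite /step mulrC divfK.
have ind i : (i <= n.+1)%N ->
    f (a + i%:R * step) - f a <= i%:R * (c * step + K * step ^+ 2).
  elim: i => [_|i ih iN]; first by rewrite !mul0r addr0 subrr.
  have {ih} := ih (ltnW iN).
  have := h (a + i%:R * step) (a + i.+1%:R * step).
  have -> : a + i.+1%:R * step - (a + i%:R * step) = step.
    by rewrite -addn1 natrD; ring.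
  have i0 : 0 <= i%:R * step by rewrite mulr_ge0.
  have ii : i%:R * step <= i.+1%:R * step by rewrite ler_wpM2r// ler_nat.
  have ib : i.+1%:R * step <= b - a by rewrite -nstep ler_wpM2r// ler_nat.
  rewrite lerDl i0 lerD2l ii -lerBrDl ib => /(_ isT isT isT).
  by rewrite -addn1 natrD; lra.
have := ind n.+1 (leqnn _); rewrite nstep addrCA subrr addr0.
move=> /le_trans; apply.
rewrite mulrDr mulrCA nstep lerD2l mulrCA.
apply: le_trans ne; rewrite expr2 (mulrA n.+1%:R) nstep /step.
by rewrite le_eqVlt; apply/orP; left; apply/eqP; field.
Qed.

End subdivision.

Lemma integrable_EFinB d (T : measurableType d) (R : realType)
    (mu : {measure set T -> \bar R}) (D : set T) (f g : T -> R) : measurable D ->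
  mu.-integrable D (EFin \o f) -> mu.-integrable D (EFin \o g) ->
  mu.-integrable D (EFin \o (fun x => f x - g x)).
Proof.
move=> mD fi gi; have := integrableB mD fi gi.
by apply: eq_integrable => // x _; rewrite /= EFinB.
Qed.

Section null_sets.
Context d (T : measurableType d) (R : realType) (mu : {measure set T -> \bar R}).
Local Open Scope ereal_scope.

Import HBNNSimple.

(** Derivatives of trajectories are almost everywhere limits of simple functions,
    hence Borel measurable only outside a null set, which is why f is arbitrary
    here. Cutting a simple minorant of f off on N leaves its integral unchanged,
    and the integral is a supremum over such minorants. *)
Lemma ge0_integral_setD_null (D N : set T) (f : T -> \bar R) :
  measurable N -> mu N = 0 -> (forall x, D x -> 0 <= f x) ->
  \int[mu]_(x in D) f x = \int[mu]_(x in D `\` N) f x.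
Proof.
move=> mN N0 f0.
have f0' x : (D `\` N) x -> 0 <= f x by case=> /f0.
rewrite !ge0_integralE//; apply/eqP; rewrite eq_le; apply/andP; split.
  apply: ge_ereal_sup => _ [h /= hf <-].
  pose h' := proj_nnsfun h (measurableC mN).
  have -> : sintegral mu h = sintegral mu h'.
    have := integral_nnsfun mu measurableT h.
    have := integral_nnsfun mu (measurableC mN) h.
    rewrite patch_setT => e1 <-.
    rewrite (@ge0_negligible_integral _ _ _ mu setT N) ?setTD//; last first.
    - by move=> x _; rewrite lee_fin.
    - exact/measurable_EFinP.
    by rewrite e1 (mrestrict h (measurableC mN)).
  apply: ereal_sup_ubound; exists h' => //= x.
  rewrite /patch; have [xN|xN] := boolP (x \in N).
    rewrite mindicE in_setC xN/= mulr0.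
    by case: ifPn => // /set_mem/f0'.
  have := hf x; rewrite /patch mindicE in_setC xN/= mulr1.
  by rewrite in_setD xN andbT.
apply: ge_ereal_sup => _ [h /= hf <-].
apply: ereal_sup_ubound; exists h => //= x.
apply: (le_trans (hf x)); rewrite /patch in_setD.
have [xD|//] := boolP (x \in D).
by rewrite /=; case: ifP => // _; exact/f0/set_mem.
Qed.

Lemma integral_setD_null (D N : set T) (f : T -> \bar R) :
  measurable N -> mu N = 0 ->
  \int[mu]_(x in D) f x = \int[mu]_(x in D `\` N) f x.
Proof.
move=> mN N0; rewrite integralE [RHS]integralE.
by congr (_ - _); apply: ge0_integral_setD_null => // x _;
  rewrite ?funepos_ge0 ?funeneg_ge0.
Qed.

Lemma Rintegral_setD_null (D N : set T) (f : T -> R) :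
  measurable N -> mu N = 0 ->
  (\int[mu]_(x in D) f x = \int[mu]_(x in D `\` N) f x)%R.
Proof. by move=> mN N0; rewrite /Rintegral (integral_setD_null _ _ mN N0). Qed.

End null_sets.

Section trajectories.
Context d (T : measurableType d) (R : realType) (mu : {measure set T -> \bar R}).
Local Notation H := (LspaceType2 mu).
Local Notation dot := (@L2_dot d T R mu).
Local Notation leb := (@lebesgue_measure R).

Lemma simple_dot_measurable (s : R -> H) (h : H) :
  finite_set (range s) -> (forall k, measurable (s @^-1` [set k])) ->
  measurable_fun setT (fun r => dot (s r) h).
Proof.
move=> fs ms _ Y mY; rewrite setTI.
have -> : (fun r => dot (s r) h) @^-1` Y =
    \bigcup_(k in range s `&` [set k | Y (dot k h)]) (s @^-1` [set k]).
  apply/seteqP; split=> [r /= Yr|r [k [_ /= Yk] /= ->]//].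
  by exists (s r) => //; split => //; exists r.
apply: fin_bigcup_measurable => //.
by apply: sub_finite_set fs => k [].
Qed.

(** The points where the simple functions fail to converge and those where the
    bound fails are gathered in a single null set N. *)
Lemma W1_regular (u g : R -> H) (a b : R) : W1infty_loc u g -> 0 < a -> a <= b ->
  exists (M : R) (N : set R), [/\ 0 <= M, measurable N, leb N = 0%E,
    (forall r, a <= r <= b -> ~ N r -> `|g r| <= M) &
    forall h, measurable_fun (`[a, b] `\` N) (fun r => dot (g r) h)].
Proof.
move=> [[[s [ss sg]] gM] _] a0 ab.
have [M MN] := gM a b a0 ab.
have [N1 [mN1 N10 sN1]] := sg.
have [N2 [mN2 N20 sN2]] := MN.
exists (Num.max M 0), (N1 `|` N2); split.
- by rewrite le_max lexx orbT.
- exact: measurableU.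
- by rewrite measureU0.
- move=> r rab nN; rewrite le_max; apply/orP; left.
  apply: contrapT => nM; apply: nN; right; apply: sN2 => /=.
  by move=> /(_ rab).
- move=> h; apply: (@measurable_fun_cvg _ _ _ _ (fun n r => dot (s n r) h)).
    move=> n; apply: (measurable_funS measurableT) => //.
    by apply: simple_dot_measurable; have [] := ss n.
  move=> r [/=]; rewrite in_itv/= => /andP[ar rb] nN.
  have r0 : `]0, +oo[%classic r by rewrite /= in_itv/= andbT (lt_le_trans a0).
  have sr : s n r @[n --> \oo] --> g r.
    by apply: contrapT => nM; apply: nN; left; apply: sN1 => /= /(_ r0).
  have -> : (fun n => dot (s n r) h) = dot h \o (s ^~ r).
    by apply/funext => n /=; rewrite dotC.
  rewrite (dotC (g r)).
  exact: (cvg_comp (s ^~ r) (dot h) sr (@dot_continuous _ _ _ _ h (g r))).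
Qed.

(** N' is at the disposal of the caller, who can put into it the exceptional
    points of an almost everywhere bound on dot (g1 r - g2 r) h. *)
Lemma W1_dot_increment_le (u1 g1 u2 g2 : R -> H) (a b : R) :
  W1infty_loc u1 g1 -> W1infty_loc u2 g2 -> 0 < a -> a <= b ->
  exists (M : R) (N : set R), [/\ 0 <= M, measurable N, leb N = 0%E,
    (forall r, a <= r <= b -> ~ N r -> `|g1 r - g2 r| <= M) &
    forall N', measurable N' -> leb N' = 0%E -> N `<=` N' ->
    forall h c s t, a <= s -> s <= t -> t <= b ->
     (forall r, s <= r <= t -> ~ N' r -> dot (g1 r - g2 r) h <= c) ->
     dot ((u1 t - u2 t) - (u1 s - u2 s)) h <= c * (t - s)].
Proof.
move=> W1 W2 a0 ab.
have [M1 [N1 [M10 mN1 N10 gM1 mg1]]] := W1_regular W1 a0 ab.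
have [M2 [N2 [M20 mN2 N20 gM2 mg2]]] := W1_regular W2 a0 ab.
exists (M1 + M2), (N1 `|` N2); split.
- exact: addr_ge0.
- exact: measurableU.
- by rewrite measureU0.
- move=> r rab nN; apply: (le_trans (ler_normB _ _)); apply: lerD.
    by apply: gM1 => // ?; apply: nN; left.
  by apply: gM2 => // ?; apply: nN; right.
move=> N' mN' N'0 NN' h c s t as_ st tb hc.
have s0 : 0 < s by exact: lt_le_trans as_.
have [_ /(_ s t h s0 st) e1] := W1.
have [_ /(_ s t h s0 st) e2] := W2.
have -> : u1 t - u2 t - (u1 s - u2 s) = (u1 t - u1 s) - (u2 t - u2 s).
  by rewrite !opprD !opprK addrACA.
have eN (f : R -> R) := @Rintegral_setD_null _ _ _ leb `[s, t] N' f mN' N'0.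
rewrite dotBl e1 e2 !eN.
pose D : set R := `[s, t] `\` N'.
have mD : measurable D by apply: measurableD.
have Dfin : (leb D < +oo)%E.
  apply: (@le_lt_trans _ _ (leb `[s, t])).
    by apply: le_measure => //; rewrite ?inE// => r [].
  by rewrite lebesgue_measure_itv/=; case: ifP => _; rewrite ?ltry// -EFinD ltry.
have int (g : R -> H) (N : set R) M : N `<=` N' ->
    (forall r, a <= r <= b -> ~ N r -> `|g r| <= M) ->
    measurable_fun (`[a, b] `\` N) (fun r => dot (g r) h) -> measurable N ->
    leb.-integrable D (EFin \o (fun r => dot (g r) h)).
  move=> sN gM mg mN; apply: measurable_bounded_integrable => //.
    apply: measurable_funS mg; first exact: measurableD.
    move=> r [/=]; rewrite !in_itv/= => /andP[sr rt] nN; split; last by move/sN.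
    by rewrite (le_trans as_ sr) (le_trans rt tb).
  exists (M * `|h|); split; first by rewrite num_real.
  move=> x Mx r [/=]; rewrite in_itv/= => /andP[sr rt] nN.
  apply: le_trans (ltW Mx); apply: (le_trans (cauchy_schwarz_abs _ _)).
  rewrite ler_wpM2r//; apply: gM; last by move/sN.
  by rewrite (le_trans as_ sr) (le_trans rt tb).
have i1 := int g1 N1 M1 (fun r Nr => NN' r (or_introl Nr)) gM1 (mg1 h) mN1.
have i2 := int g2 N2 M2 (fun r Nr => NN' r (or_intror Nr)) gM2 (mg2 h) mN2.
rewrite -RintegralB//.
apply: (@le_trans _ _ (\int[leb]_(r in D) c)).
  apply: le_Rintegral => //.
  - exact: (@integrable_EFinB _ _ _ leb D _ _ mD i1 i2).
  - apply: measurable_bounded_integrable => //; exists `|c|; split; first by rewrite num_real.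
    by move=> x cx r _ /=; exact: ltW.
  - move=> r [/=]; rewrite in_itv/= => srt nN.
    by rewrite -dotBl; exact: hc.
rewrite -eN Rintegral_cst//= lebesgue_measure_itv/= lte_fin.
case: ifP => [_|/negbT]; first by rewrite -EFinD.
rewrite -leNgt => ts; have -> : s = t by apply: le_anti; rewrite st ts.
by rewrite subrr.
Qed.

(** F is convex with 1-Lipschitz gradient n. With z = u1 - u2, the increment of F
    on [s, t] is at most <n (z t), z t - z s>, the integral of <g1 - g2, n (z t)>.
    Replacing n (z t) by n (z r) in the integrand costs O(t - s) because z and n
    are Lipschitz, hence O((t - s)^2) after integration. *)
Lemma trajectory_increment (u1 g1 u2 g2 : R -> H) (a b c : R) (F : H -> R) (n : H -> H) :
  W1infty_loc u1 g1 -> W1infty_loc u2 g2 -> 0 < a -> a <= b ->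
  (forall x y, F y - F x <= dot (n y) (y - x)) ->
  (forall x y, `|n y - n x| <= `|y - x|) ->
  {ae leb, forall r, a <= r <= b -> dot (g1 r - g2 r) (n (u1 r - u2 r)) <= c} ->
  F (u1 b - u2 b) - F (u1 a - u2 a) <= c * (b - a).
Proof.
move=> W1 W2 a0 ab Fn nlip [N3 [mN3 N30 sN3]].
have [M [N [M0 mN N0 gM inc]]] := W1_dot_increment_le W1 W2 a0 ab.
pose z r := u1 r - u2 r.
have mN' : measurable (N `|` N3 : set R) by exact: measurableU.
have N'0 : leb (N `|` N3) = 0%E by rewrite measureU0.
have {}inc := inc _ mN' N'0 (@subsetUl _ N N3).
have itv s t r : a <= s -> t <= b -> s <= r <= t -> a <= r <= b.
  by move=> as_ tb /andP[sr rt]; rewrite (le_trans as_ sr) (le_trans rt tb).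
have zlip s t : a <= s -> s <= t -> t <= b -> `|z t - z s| <= M * (t - s).
  move=> as_ st tb.
  have := inc (z t - z s) (M * `|z t - z s|) s t as_ st tb.
  rewrite -/(z t) -/(z s) L2_dot_norm => h.
  have {h} : `|z t - z s| ^+ 2 <= M * `|z t - z s| * (t - s).
    apply: h => r srt nN; apply: (le_trans (cauchy_schwarz _ _)).
    rewrite ler_wpM2r//; apply: gM; first exact: itv srt.
    by move=> Nr; apply: nN; left.
  have [->|n0] := eqVneq (z t - z s) 0.
    by rewrite normr0 => _; rewrite mulr_ge0// subr_ge0.
  by rewrite expr2 mulrAC ler_pM2r// normr_gt0.
apply: (@increment_le _ (fun r => F (z r)) a b c (M * M)) => //; first exact: mulr_ge0.
move=> s t as_ st tb; apply: (le_trans (Fn (z s) (z t))); rewrite dotC.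
have -> : c * (t - s) + M * M * (t - s) ^+ 2 = (c + M * (M * (t - s))) * (t - s) by ring.
apply: inc => // r srt nN.
have rab := itv _ _ _ as_ tb srt.
rewrite -[n (z t)](subrKC (n (z r))) dotDr; apply: lerD.
  apply: contrapT => nc; apply: nN; right; apply: sN3 => /=.
  by move=> /(_ rab).
apply: (le_trans (cauchy_schwarz _ _)); apply: ler_pM => //.
  by apply: gM => // Nr; apply: nN; left.
have /andP[sr rt] := srt.
apply: (le_trans (nlip _ _)); apply: (le_trans (zlip _ _ (le_trans as_ sr) rt tb)).
by rewrite ler_wpM2l// lerB.
Qed.

Lemma continuous_at0 (u : R -> H) (e : R) : {within `[0, +oo[, continuous u} -> 0 < e ->
  exists2 del : R, 0 < del & forall r, 0 <= r -> r < del -> `|u 0 - u r| < e.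
Proof.
move=> uc e0.
have : nbhs (u 0) [set v | `|u 0 - v| < e] by apply/nbhs_normP; exists e.
have A0 : `[0, +oo[%classic (0 : R) by rewrite /= in_itv/= lexx.
move=> /(uc 0); rewrite nbhs_filterE /nbhs/= -(nbhs_subspace_in A0).
move=> /nbhs_ballP[del /= del0 h]; exists del => // r r0 rdel.
apply: (h r); last by rewrite /= in_itv/= andbT.
by rewrite /ball/= sub0r normrN ger0_norm.
Qed.

Lemma ae_leb_sub (P Q : R -> Prop) : (forall r, P r -> Q r) ->
  {ae leb, forall r, P r} -> {ae leb, forall r, Q r}.
Proof.
move=> PQ [N [mN N0 sN]]; exists N; split=> // r nQ.
by apply: sN => /= Pr; apply: nQ; exact: PQ.
Qed.

Lemma ae_leb_and (P Q : R -> Prop) :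
  {ae leb, forall r, P r} -> {ae leb, forall r, Q r} -> {ae leb, forall r, P r /\ Q r}.
Proof.
move=> [N [mN N0 sN]] [N' [mN' N'0 sN']]; exists (N `|` N'); split.
- exact: measurableU.
- by rewrite measureU0.
- move=> r nPQ; have [Pr|nP] := pselect (P r); last by left; exact: sN.
  by right; apply: sN' => Qr; exact: nPQ.
Qed.

(** The derivatives may be unbounded near 0, so the estimate on [a, b] is passed
    to the limit a -> 0 by continuity of the trajectories. *)
Lemma trajectory_increment0 (u1 g1 u2 g2 : R -> H) (b c : R) (F : H -> R) (n : H -> H) :
  W1infty_loc u1 g1 -> W1infty_loc u2 g2 -> 0 < b ->
  {within `[0, +oo[, continuous u1} -> {within `[0, +oo[, continuous u2} ->
  (forall x y, F y - F x <= dot (n y) (y - x)) ->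
  (forall x y, `|n y - n x| <= `|y - x|) ->
  {ae leb, forall r, 0 < r -> r <= b -> dot (g1 r - g2 r) (n (u1 r - u2 r)) <= c} ->
  F (u1 b - u2 b) - F (u1 0 - u2 0) <= c * b.
Proof.
move=> W1 W2 b0 c1 c2 Fn nlip hc; apply/ler_addgt0Pr => e e0.
pose z r := u1 r - u2 r.
(* factor of eta in the total error made by starting at a instead of 0 *)
pose B := `|n (z 0)| + 1 + `|c|.
have B0 : 0 < B by rewrite /B -addrA ltr_wpDl// ltr_pwDl.
pose eta := Num.min 1 (e / B).
have eta0 : 0 < eta by rewrite lt_min ltr01 divr_gt0.
have [d1 d10 h1] := continuous_at0 c1 (divr_gt0 eta0 (ltr0Sn R 1)).
have [d2 d20 h2] := continuous_at0 c2 (divr_gt0 eta0 (ltr0Sn R 1)).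
pose a := Num.min (Num.min d1 d2) (Num.min b eta) / 2.
have a20 : 0 < Num.min (Num.min d1 d2) (Num.min b eta) by rewrite 3!lt_min d10 d20 b0.
have a0 : 0 < a by rewrite divr_gt0.
have : a < Num.min (Num.min d1 d2) (Num.min b eta) by rewrite ltr_pdivrMr// ltr_pMr// ltr1n.
rewrite 3!lt_min => /andP[/andP[ad1 ad2] /andP[ab aeta]].
have za : `|z a - z 0| <= eta.
  have -> : z a - z 0 = (u2 0 - u2 a) - (u1 0 - u1 a).
    by rewrite /z !opprB addrACA [RHS]addrACA (addrC (u2 0)).
  apply: (le_trans (ler_normB _ _)); rewrite [leRHS]splitr.
  by apply: lerD; apply/ltW; [apply: h2|apply: h1] => //; exact: ltW.
have hc' : {ae leb, forall r, a <= r <= b -> dot (g1 r - g2 r) (n (u1 r - u2 r)) <= c}.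
  by apply: ae_leb_sub hc => r + /andP[ar rb]; apply => //; exact: lt_le_trans ar.
have := trajectory_increment W1 W2 a0 (ltW ab) Fn nlip hc'.
rewrite -/(z a) -/(z b) -/(z 0) => i1.
have i2 := Fn (z 0) (z a).
have i3 : dot (n (z a)) (z a - z 0) <= (`|n (z 0)| + 1) * eta.
  apply: (le_trans (cauchy_schwarz _ _)); apply: ler_pM => //.
  rewrite -[n (z a)](subrKC (n (z 0))); apply: (le_trans (ler_normD _ _)).
  rewrite lerD2l; apply: (le_trans (nlip _ _)); apply: (le_trans za).
  by rewrite ge_min lexx.
have i4 : - (c * a) <= `|c| * eta.
  apply: (le_trans (ler_norm _)); rewrite normrN normrM (gtr0_norm a0).
  by rewrite ler_wpM2l// ltW.
have i5 : B * eta <= e.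
  by rewrite mulrC -ler_pdivlMr// ge_min lexx orbT.
move: i1 i2 i3 i4 i5; rewrite /B; lra.
Qed.

End trajectories.

(** * Penalized functionals and resolvents *)

Section nested_compact.
Context (X : topologicalType) (I : Type).

Lemma nested_compact_nonempty (A : set X) (D : set I) (F : I -> set X) i0 :
  compact A -> D i0 -> F i0 `<=` A ->
  (forall i, D i -> F i !=set0) -> (forall i, D i -> closed (F i)) ->
  (forall i k, D i -> D k -> F i `<=` F k \/ F k `<=` F i) ->
  exists x, forall i, D i -> F i x.
Proof.
move=> cA Di0 Fi0 F0 Fcl Fnest.
have FF : Filter (filter_from D F).
  apply: filter_from_filter; first by exists i0.
  move=> i k Di Dk; have [ik|ki] := Fnest i k Di Dk.
    by exists i => // x Fx; split => //; exact: ik.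
  by exists k => // x Fx; split => //; exact: ki.
have PF : ProperFilter (filter_from D F) by apply: filter_from_proper.
have [x [_ xF]] := cA _ PF (ex_intro2 _ _ i0 Di0 Fi0).
exists x => i Di; rewrite (closure_id (F i)).1; last exact: Fcl.
by move=> B Bx; apply: xF => //; exists i.
Qed.

End nested_compact.

Section convex_functionals.
Context d (T : measurableType d) (R : realType) (mu : {measure set T -> \bar R}).
Local Notation H := (LspaceType2 mu).
Local Notation dot := (@L2_dot d T R mu).
Context (V : tvsType R) (j : {linear V -> H}) (phi : V -> \bar R).
Hypothesis phi_Ny : never_Ny phi.
Hypothesis phi_convex : convex_functional phi.
Implicit Types (u p f h : H) (v w : V).

Definition subgradient_at v f := effdom phi v /\
  forall w, (phi v + (dot f (j w - j v))%:E <= phi w)%E.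

Lemma effdom_fineK v : effdom phi v -> phi v = (fine (phi v))%:E.
Proof.
move=> /= pv; rewrite fineK// fin_numE phi_Ny/=.
by rewrite lt_eqF.
Qed.

Lemma effdom_le v (c : R) : (phi v <= c%:E)%E -> effdom phi v.
Proof. by move=> /le_lt_trans; apply; exact: ltry. Qed.

Lemma effdom_real v : effdom phi v -> exists r : R, phi v = r%:E.
Proof. by move=> vD; exists (fine (phi v)); exact: effdom_fineK. Qed.

(** By convexity the difference quotients in the direction w - v are, for t <= 1,
    at most phi w - phi v; conversely the global inequality at v + t w bounds
    every quotient from below. *)
Lemma jsubgradP u f : jsubgrad j phi (u, f) <-> exists2 v, j v = u & subgradient_at v f.
Proof.
split=> [[v0 [/= v0D <-] h]|[v0 <- [v0D h]]].
  exists v0 => //; split=> // w; have [r0 e0] := effdom_real v0D.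
  have [wD|] := boolP (phi w < +oo)%E; last first.
    by rewrite -leNgt leye_eq => /eqP ->; rewrite leey.
  have [r e] := effdom_real wD; rewrite e0 e -EFinD lee_fin.
  have : (limf_einf (fun t : R => (phi (v0 + t *: (w - v0))%R - phi v0) * (t^-1)%:E) 0^'+
      <= (r - r0)%:E)%E.
    rewrite limf_einfE; apply: ge_ereal_sup => _ [A FA <-].
    have : \forall t \near (0 : R)^'+, A t /\ t < 1 /\ 0 < t.
      near=> t; split; first by near: t.
      by split; near: t; [exact: nbhs_right_lt|exact: nbhs_right_gt].
    move=> /filter_ex[t [At [t1 t0]]].
    apply: (@le_trans _ _ ((phi (v0 + t *: (w - v0))%R - phi v0) * (t^-1)%:E)%E).
      by apply: ereal_inf_lbound; exists t.
    have -> : v0 + t *: (w - v0) = t *: w + (1 - t) *: v0.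
      by rewrite scalerBr scalerBl scale1r addrA addrAC addrC addrA.
    have := phi_convex w v0 (t := t); rewrite (ltW t0) (ltW t1) => /(_ isT).
    rewrite e0 e -!EFinM -EFinD => hc.
    have [s es] := effdom_real (effdom_le hc); rewrite es in hc *.
    rewrite -EFinB -EFinM lee_fin ler_pdivrMr//.
    by move: hc; rewrite lee_fin; lra.
  move=> /(le_trans (h (w - v0))); rewrite lee_fin linearB; lra.
have [r0 e0] := effdom_real v0D.
exists v0 => // w; rewrite limf_einfE; apply: le_ereal_sup_tmp.
pose q (t : R) := ((phi (v0 + t *: w)%R - phi v0) * (t^-1)%:E)%E.
exists (ereal_inf (q @` [set t | 0 < t])).
  by exists [set t | 0 < t] => //; exact: nbhs_right_gt.
apply: le_ereal_inf_tmp => _ [t /= t0 <-]; rewrite /q.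
have := h (v0 + t *: w).
have -> : j (v0 + t *: w) - j v0 = t *: j w by rewrite linearD linearZ/= addrC addKr.
rewrite dotZr.
rewrite e0 -EFinD.
have [wD|] := boolP (phi (v0 + t *: w)%R < +oo)%E.
  have [r ->] := effdom_real wD; rewrite -EFinB -EFinM !lee_fin ler_pdivlMr//; lra.
rewrite -leNgt leye_eq => /eqP -> _.
by rewrite addye// mulyr gtr0_sg ?invr_gt0// mul1e leey.
Unshelve. all: by end_near. Qed.

End convex_functionals.

Section penalized.
Context d (T : measurableType d) (R : realType) (mu : {measure set T -> \bar R}).
Local Notation H := (LspaceType2 mu).
Local Notation dot := (@L2_dot d T R mu).
Context (V : tvsType R) (j : {linear V -> H}) (phi : V -> \bar R).
Hypothesis j_weak : weakly_continuous j.
Hypothesis phi_Ny : never_Ny phi.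
Hypothesis phi_convex : convex_functional phi.
Hypothesis phi_lsc : lsc_functional phi.
Implicit Types (u p f h : H) (v w : V) (k c : R).

(** Its minimum over v is the Moreau envelope at p, with parameter 1 / k, of the
    infimum of phi over the fibres of j. *)
Definition penalized k p v := (phi v + (k / 2 * `|j v - p| ^+ 2)%:E)%E.

Lemma dot_j_continuous h : continuous (fun v => dot h (j v) : R^o).
Proof.
move=> v B hB.
have h1 := @weak_continuous R H (dot h : {linear H -> R^o}) (@dot_continuous _ _ _ _ h) (j v) B hB.
exact: (@id_weak_continuous R V v _ (j_weak h1)).
Qed.

Lemma closed_sublevel_add (l : V -> R^o) c : continuous l ->
  closed [set v | (phi v + (l v)%:E <= c%:E)%E].
Proof.
move=> lc; rewrite -[X in closed X]setCK; apply: open_closedC.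
rewrite openE => v /= /negP; rewrite -ltNge => cv.
have [a [av ca]] : exists a : R, (a%:E < phi v)%E /\ c < a + l v.
  move: cv (phi_Ny v); case: (phi v) => [r| |]//=.
    rewrite -EFinD lte_fin => cr _; exists (r - (r + l v - c) / 2).
    rewrite lte_fin; split; lra.
  by move=> _ _; exists (c - l v + 1); rewrite ltry; split => //; lra.
have n1 : nbhs v [set w | ~ (phi w <= a%:E)%E].
  apply: open_nbhs_nbhs; split; last by apply/negP; rewrite -ltNge.
  by rewrite openC; exact: phi_lsc.
have n2 : nbhs v (l @^-1` [set y | c - a < y]).
  by apply: lc; apply: open_nbhs_nbhs; split; [exact: open_gt|rewrite /=; lra].
apply: filterS2 n1 n2 => w /negP; rewrite -ltNge => aw lw /= h.
have : (a%:E + (l w)%:E < c%:E)%E by apply: lt_le_trans h; rewrite lteD2rE.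
by move: lw; rewrite /= -EFinD lte_fin; lra.
Qed.

Lemma sublevel_real v (a c : R) : (phi v + a%:E <= c%:E)%E ->
  exists2 r, phi v = r%:E & r + a <= c.
Proof.
by have := phi_Ny v; case: (phi v) => [r _ h| |//]//; exists r.
Qed.

Lemma convex_sublevel_add (l : V -> R) c :
  (forall x y t, l (t *: x + (1 - t) *: y) = t * l x + (1 - t) * l y) ->
  convex_set [set v | (phi v + (l v)%:E <= c%:E)%E].
Proof.
move=> la; apply/convex_setE => x y t /= /sublevel_real[r er hx] /sublevel_real[s es hy] t01.
have := phi_convex x y t01; rewrite er es -!EFinM -EFinD => hz.
have [q eq] := effdom_real phi_Ny (effdom_le hz).
move: hz; rewrite eq -!EFinD !lee_fin la => hz.
have /andP[t0 t1] := t01.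
have a1 := ler_wpM2l t0 hx.
have a2 : (1 - t) * (s + l y) <= (1 - t) * c by apply: ler_wpM2l => //; lra.
lra.
Qed.

(** The squared norm is the supremum of its affine minorants, so a sublevel of the
    penalized functional is an intersection of sublevels of phi plus a continuous
    affine function of v; these are closed and convex, hence weakly closed. *)
Lemma penalized_sublevelE k p c : 0 <= k ->
  [set v | (penalized k p v <= c%:E)%E] =
  \bigcap_(h in [set: H])
    [set v | (phi v + (k * (dot h (j v) - dot h p) - k / 2 * `|h| ^+ 2)%:E <= c%:E)%E].
Proof.
move=> k0; apply/seteqP; split=> [v /= hv h _ /=|v /= /(_ (j v - p) I)/=].
  apply: le_trans hv; apply: leeD2l; rewrite lee_fin.
  rewrite -dotBr; move: (j v - p) => x.
  have := dot_ge0 (x - h); rewrite !dotE (dotC x h) !L2_dot_norm => hn.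
  have := mulr_ge0 k0 hn; lra.
rewrite -dotBr L2_dot_norm; apply: le_trans; apply: leeD2l; rewrite lee_fin; lra.
Qed.

Lemma penalized_sublevel_weakly_closed k p c : 0 <= k ->
  closed ([set v | (penalized k p v <= c%:E)%E] : set (weak_type V)).
Proof.
move=> k0; rewrite penalized_sublevelE//; apply: closed_bigI => h _.
apply: closed_convex_weakly_closed.
  apply: (closed_sublevel_add (l := fun v => k * (dot h (j v) - dot h p) - k / 2 * `|h| ^+ 2)).
  move=> v; apply: (@cvgB _ R^o); last exact: cvg_cst.
  apply: (@cvgM R^o); first exact: cvg_cst.
  apply: (@cvgB _ R^o); last exact: cvg_cst.
  exact: dot_j_continuous.
apply: convex_sublevel_add => x y t.
by rewrite linearD !linearZ/= dotDr !dotZr; ring.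
Qed.

Context (omega : R).
Hypothesis omega_ge0 : 0 <= omega.
Hypothesis phi_coercive : coercive (fun v => phi v + (omega / 2 * `|j v| ^+ 2)%:E)%E.

(** Completing the square, k / 2 |x - p|^2 exceeds omega / 2 |x|^2 up to a
    constant as soon as k > omega, so the sublevels are contained in those of
    the functional that ellipticity makes coercive. *)
Lemma penalized_sublevel_compact k p c : omega < k ->
  compact ([set v | (penalized k p v <= c%:E)%E] : set (weak_type V)).
Proof.
move=> ok; have k0 : 0 <= k by apply: le_trans omega_ge0 (ltW ok).
have ko : 0 < k - omega by rewrite subr_gt0.
pose c' := c - k / 2 * `|p| ^+ 2 + k ^+ 2 / (2 * (k - omega)) * `|p| ^+ 2.
apply: (subclosed_compact (@penalized_sublevel_weakly_closed k p c k0) (@phi_coercive c')).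
apply: subset_trans (@subset_closure _ _) => v /= /sublevel_real[r -> hr].
rewrite -EFinD lee_fin /c'.
have := dot_ge0 ((k - omega) *: j v - k *: p).
rewrite !dotE (dotC p) !L2_dot_norm.
have : `|j v - p| ^+ 2 = `|j v| ^+ 2 - 2 * dot (j v) p + `|p| ^+ 2.
  by rewrite -!L2_dot_norm !dotE (dotC p); ring.
move: hr => /[swap] ->.
move: (dot (j v) p) (`|j v| ^+ 2) (`|p| ^+ 2) => a b q hr hd.
have {}hd : 0 <= (k - omega) / 2 * b - k * a + k ^+ 2 / (2 * (k - omega)) * q.
  rewrite -(pmulr_rge0 _ ko) -(@pmulr_rge0 _ 2)//.
  apply: (le_trans hd); rewrite le_eqVlt; apply/orP; left; apply/eqP; field.
  by rewrite gt_eqF.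
lra.
Qed.

(** The nonempty sublevels form a chain of weakly compact sets, and a point common
    to all of them is a minimizer. *)
Lemma penalized_minimizer k p : proper_functional phi -> omega < k ->
  exists2 v0, effdom phi v0 & forall v, (penalized k p v0 <= penalized k p v)%E.
Proof.
move=> [w wD] ok.
pose D := [set c | exists v, (penalized k p v <= c%:E)%E].
pose F c := [set v | (penalized k p v <= c%:E)%E] : set (weak_type V).
have k0 : 0 <= k by apply: le_trans omega_ge0 (ltW ok).
have [r er] := effdom_real phi_Ny wD.
pose c0 := r + k / 2 * `|j w - p| ^+ 2.
have Dc0 : D c0 by exists w; rewrite /penalized er.
have [x xF] : exists x : weak_type V, forall c, D c -> F c x.
  apply: (@nested_compact_nonempty (weak_type V) R (F c0) D F c0) => //.
  - exact: penalized_sublevel_compact.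
  - by move=> c Dc; exact: penalized_sublevel_weakly_closed.
  - move=> c c' _ _; have [cc'|c'c] := leP c c'; [left|right] => v /= /le_trans; apply.
      by rewrite lee_fin.
    by rewrite lee_fin ltW.
exists x => [|v].
  by have /sublevel_real[s es _] := xF _ Dc0; rewrite /effdom/= es ltry.
have := phi_Ny v; rewrite {2}/penalized; case e : (phi v) => [s| |//] _.
  by apply: xF; exists v; rewrite /penalized e.
by rewrite addye// leey.
Qed.

(** As the penalty weight tends to infinity, sublevels of the penalized
    functional shrink to the fibre of j over p, and compactness keeps a point. *)
Lemma penalty_attained p c :
  (forall k, omega < k -> exists v, (penalized k p v <= c%:E)%E) ->
  exists2 v, j v = p & (phi v <= c%:E)%E.
Proof.
move=> h.
pose F k := [set v | (penalized k p v <= c%:E)%E] : set (weak_type V).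
have k0 k : omega < k -> 0 <= k by move=> ok; apply: le_trans omega_ge0 (ltW ok).
have o1 : omega < omega + 1 by rewrite ltrDl.
have mono k k' : k <= k' -> F k' `<=` F k.
  move=> kk' v /=; apply: le_trans; apply: leeD2l; rewrite lee_fin.
  by rewrite ler_wpM2r ?sqr_ge0// ler_wpM2r// invr_ge0.
have [x xF] : exists x : weak_type V, forall k, omega < k -> F k x.
  apply: (@nested_compact_nonempty (weak_type V) R (F (omega + 1))
    [set k | omega < k] F (omega + 1)) => //.
  - exact: penalized_sublevel_compact.
  - by move=> k /k0 ?; exact: penalized_sublevel_weakly_closed.
  - by move=> k k' _ _; have [/mono|/ltW/mono] := leP k k'; [right|left].
have /sublevel_real[r er hr] := xF _ o1.
have jx : j x = p.
  apply: contrapT => /eqP; rewrite -subr_eq0 -normr_gt0 => n0.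
  have n20 : 0 < `|j x - p| ^+ 2 by rewrite exprn_gt0.
  (* large enough for k / 2 |j x - p|^2 to exceed c - r *)
  pose k := omega + 1 + 2 * (`|c - r| + 1) / `|j x - p| ^+ 2.
  have ok : omega < k.
    by rewrite /k -addrA ltrDl ltr_pwDl// divr_ge0 ?sqr_ge0// mulr_ge0// addr_ge0.
  have := xF k ok; rewrite /F/= /penalized er -EFinD lee_fin => {}h.
  have : k / 2 * `|j x - p| ^+ 2 = (omega + 1) / 2 * `|j x - p| ^+ 2 + (`|c - r| + 1).
    by rewrite /k; field; rewrite gt_eqF.
  have : 0 <= (omega + 1) / 2 * `|j x - p| ^+ 2.
    by rewrite mulr_ge0 ?sqr_ge0// divr_ge0// addr_ge0.
  by have := ler_norm (c - r); lra.
exists x => //; have := xF _ o1; rewrite /F/= /penalized jx subrr normr0 expr0n/= mulr0.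
by rewrite adde0.
Qed.

End penalized.

Section resolvent.
Context d (T : measurableType d) (R : realType) (mu : {measure set T -> \bar R}).
Local Notation H := (LspaceType2 mu).
Local Notation dot := (@L2_dot d T R mu).

Lemma ge0_of_quadratic (a b : R) :
  (forall t, 0 < t -> t <= 1 -> 0 <= t * a + t ^+ 2 * b) -> 0 <= a.
Proof.
move=> h; apply/ler_addgt0Pr => e e0.
pose t := Num.min 1 (e / (`|b| + 1)).
have b1 : 0 < `|b| + 1 by rewrite ltr_wpDl.
have t0 : 0 < t by rewrite lt_min ltr01 divr_gt0.
have t1 : t <= 1 by rewrite ge_min lexx.
have te : t * (`|b| + 1) <= e by rewrite -ler_pdivlMr// ge_min lexx orbT.
have := h t t0 t1; rewrite expr2 -mulrA -mulrDr pmulr_rge0// => {}h.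
have tb : t * b <= t * (`|b| + 1).
  by rewrite ler_pM2l//; have := ler_norm b; lra.
lra.
Qed.

Context (V : tvsType R) (j : {linear V -> H}) (phi : V -> \bar R).
Hypothesis phi_Ny : never_Ny phi.
Hypothesis phi_convex : convex_functional phi.

(** Minimality along the segment from v0 to w is a quadratic inequality in the
    parameter t, whose linear coefficient is the subgradient inequality. *)
Lemma minimizer_subgradient k p v0 : effdom phi v0 ->
  (forall v, (penalized j phi k p v0 <= penalized j phi k p v)%E) ->
  subgradient_at j phi v0 (k *: (p - j v0)).
Proof.
move=> v0D h; split=> // w; have [r0 e0] := effdom_real phi_Ny v0D.
have := phi_Ny w; case e : (phi w) => [r| |//] _; last by rewrite leey.
rewrite e0 -EFinD lee_fin -subr_ge0.
apply: (@ge0_of_quadratic _ (k / 2 * `|j w - j v0| ^+ 2)) => t t0 t1.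
have t01 : 0 <= t <= 1 by rewrite (ltW t0).
have := phi_convex w v0 t01; rewrite e e0 -!EFinM -EFinD => hz.
have [s es] := effdom_real phi_Ny (effdom_le hz).
have := h (t *: w + (1 - t) *: v0); rewrite /penalized e0 es -!EFinD lee_fin.
move: hz; rewrite es lee_fin.
have -> : j (t *: w + (1 - t) *: v0) - p = t *: (j w - j v0) - (p - j v0).
  rewrite linearD !linearZ/= scalerBr scalerBl scale1r.
  by rewrite opprB addrA -!addrA; congr (_ + _); rewrite addrCA.
rewrite -(normrN (j v0 - p)) opprB dotZl -!L2_dot_norm.
move: (j w - j v0) (p - j v0) => x y.
by rewrite !dotE (dotC y x); lra.
Qed.

Lemma resolvent_exists omega k p : weakly_continuous j -> lsc_functional phi ->
  proper_functional phi -> 0 <= omega ->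
  coercive (fun v => phi v + (omega / 2 * `|j v| ^+ 2)%:E)%E -> omega < k ->
  exists v, subgradient_at j phi v (k *: (p - j v)).
Proof.
move=> jw pl pp o0 pc ok.
have [v vD vmin] := penalized_minimizer jw phi_Ny phi_convex pl o0 pc p pp ok.
by exists v; exact: minimizer_subgradient.
Qed.

End resolvent.

Lemma subr_telescope (Z : zmodType) (p q x y : Z) :
  q - p = (q - y) - (p - x) + (y - x).
Proof. by rewrite opprB -addrA (addrC (x - p)) !subrKA. Qed.

(** * The functional on H is the infimum over the fibres of j *)

Section H_functional.
Context d (T : measurableType d) (R : realType) (mu : {measure set T -> \bar R}).
Local Notation H := (LspaceType2 mu).
Local Notation dot := (@L2_dot d T R mu).
Implicit Types (p q x y f : H) (k c : R).

(** Here x and y are the resolvents of p and q for a functional with values a and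
    b there, so a + k / 2 |p - x|^2 and b + k / 2 |q - y|^2 are its Moreau
    envelope at p and q. This lemma and the next one say that the envelope is
    differentiable at p, with gradient k (p - x). *)
Lemma envelope_ge k p q x y (a b : R) : 0 <= k ->
  a + k * dot (p - x) (y - x) <= b ->
  k * dot (p - x) (q - p) <= (b + k / 2 * `|q - y| ^+ 2) - (a + k / 2 * `|p - x| ^+ 2).
Proof.
move=> k0.
have -> : q - p = (q - y) - (p - x) + (y - x).
  exact: subr_telescope.
move: (q - y) (p - x) (y - x) => Q P z h.
have := mulr_ge0 k0 (dot_ge0 (Q - P)).
rewrite -!L2_dot_norm !dotE (dotC Q P); lra.
Qed.

Lemma envelope_le k p q x y (a b : R) : 0 <= k ->
  a + k * dot (p - x) (y - x) <= b -> b + k * dot (q - y) (x - y) <= a ->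
  (b + k / 2 * `|q - y| ^+ 2) - (a + k / 2 * `|p - x| ^+ 2)
    <= k * dot (p - x) (q - p) + k * `|q - p| ^+ 2.
Proof.
move=> k0.
have -> : q - p = (q - y) - (p - x) + (y - x).
  exact: subr_telescope.
rewrite -(opprB y x) dotNr.
move: (q - y) (p - x) (y - x) => Q P z h1 h2.
have h3 := mulr_ge0 k0 (dot_ge0 (Q - P)).
have h4 := mulr_ge0 k0 (dot_ge0 z).
move: h1 h2 h3 h4; rewrite -!L2_dot_norm !dotE (dotC Q P) (dotC z P) (dotC z Q); lra.
Qed.

(** The subgradient at x0 is an affine minorant of psi; it forces x to tend to p
    as k tends to infinity while psi x stays below c. *)
Lemma lsc_penalty (psi : H -> \bar R) (omega : R) x0 f0 p c :
  never_Ny psi -> lsc_functional psi -> subgradient_at idfun psi x0 f0 -> 0 <= omega ->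
  (forall k, omega < k -> exists x, (penalized idfun psi k p x <= c%:E)%E) ->
  (psi p <= c%:E)%E.
Proof.
move=> psiN pl [x0D x0f] o0 h.
have [r0 e0] := effdom_real psiN x0D.
have [bet hb] : exists bet, r0 + dot f0 (p - x0) = bet by eexists.
suff : closure [set x | (psi x <= c%:E)%E] p.
  by rewrite -(closure_id _).1//; exact: pl.
move=> B /nbhs_normP[e e_gt0 eB].
have [C CE] : exists C, C = `|c - bet| / e + `|f0| by eexists.
have C0 : 0 <= C by rewrite CE addr_ge0// divr_ge0// ltW.
(* then k e / 2 >= C + 1, which rules out |x - p| >= e *)
have [k kE] : exists k, k = omega + 2 * (C + 1) / e by eexists.
have [x hx] : exists x, (penalized idfun psi k p x <= c%:E)%E.
  by apply: h; rewrite kE ltrDl divr_gt0// mulr_gt0// ltr_wpDl.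
have k0 : 0 <= k.
  by rewrite kE addr_ge0// divr_ge0 ?(ltW e_gt0)// mulr_ge0// addr_ge0.
have /(sublevel_real psiN)[r er hr] := hx.
have xp0 : 0 <= k / 2 * `|x - p| ^+ 2 by rewrite mulr_ge0 ?sqr_ge0// divr_ge0.
exists x; split; first by rewrite /= er lee_fin; apply: le_trans hr; rewrite lerDl.
apply: eB; rewrite ltNge; apply/negP; rewrite distrC => en.
have n0 : 0 < `|x - p| by exact: lt_le_trans en.
have := x0f x; rewrite e0 er -EFinD lee_fin /= => h1.
have h2 : dot f0 (x - x0) = dot f0 (p - x0) + dot f0 (x - p).
  by rewrite !dotBr; ring.
have h3 := cauchy_schwarz f0 (p - x).
have h4 : dot f0 (p - x) = - dot f0 (x - p) by rewrite -dotNr opprB.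
have h5 : c - bet <= `|c - bet| / e * `|x - p|.
  apply: (le_trans (ler_norm _)); rewrite mulrAC ler_pdivlMr//.
  by rewrite ler_wpM2l.
have h6 : k / 2 * `|x - p| ^+ 2 <= C * `|x - p|.
  rewrite distrC h4 in h3; rewrite h2 in h1.
  have hr' : r + k / 2 * `|x - p| ^+ 2 <= c := hr.
  rewrite CE [leRHS]mulrDl; lra.
have h7 : k / 2 * e * `|x - p| <= C * `|x - p|.
  apply: le_trans h6; rewrite expr2 -mulrA; apply: ler_wpM2l; first by rewrite divr_ge0.
  by rewrite ler_pM2r.
move: h7; rewrite ler_pM2r//.
have -> : k / 2 * e = omega / 2 * e + (C + 1) by rewrite kE; field; rewrite gt_eqF.
have : 0 <= omega / 2 * e by rewrite mulr_ge0 ?(ltW e_gt0)// divr_ge0.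
lra.
Qed.

Context (V : tvsType R) (j : {linear V -> H}) (phi : V -> \bar R).
Hypothesis j_weak : weakly_continuous j.
Hypothesis phi_Ny : never_Ny phi.
Hypothesis phi_convex : convex_functional phi.
Hypothesis phi_proper : proper_functional phi.
Hypothesis phi_lsc : lsc_functional phi.
Context (omega : R).
Hypothesis omega_ge0 : 0 <= omega.
Hypothesis phi_coercive : coercive (fun v => phi v + (omega / 2 * `|j v| ^+ 2)%:E)%E.
Context (psi : H -> \bar R).
Hypothesis psiH : is_H_functional j phi psi.

Let resolvent k p : omega < k -> exists v, subgradient_at j phi v (k *: (p - j v)).
Proof. by move=> ok; exact: (resolvent_exists _ _ _ j_weak _ _ omega_ge0 phi_coercive). Qed.

Lemma H_functional_subgradient v f : subgradient_at j phi v f ->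
  subgradient_at idfun psi (j v) f.
Proof.
move=> vf; have [psiN psic _ _ sub] := psiH.
have : subgrad psi (j v, f).
  by apply: sub; apply/jsubgradP => //; exists v.
by move=> /(@jsubgradP _ _ _ _ H idfun psi psiN psic (j v) f)[w /= <-].
Qed.

(** For k = omega + 1, v and w are resolvents of two points p and q. Along the
    segment from p to q the envelopes of phi and psi have the same gradient, so
    their difference, which is psi (j v) - phi v at the resolvent v, has
    increments of quadratic size and is therefore constant. *)
Lemma H_functional_shift_le v f w g :
  subgradient_at j phi v f -> subgradient_at j phi w g ->
  fine (psi (j w)) - fine (phi w) <= fine (psi (j v)) - fine (phi v).
Proof.
move=> vf wg; have [psiN psic _ _ sub] := psiH.
pose k := omega + 1.
have ok : omega < k by rewrite ltrDl.
have k_gt0 : 0 < k by exact: le_lt_trans ok.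
have k0 := ltW k_gt0.
have step y h : exists p, k *: (p - y) = h.
  by exists (y + k^-1 *: h); rewrite addrC addKr scalerA divff ?gt_eqF// scale1r.
have [p kp] := step (j v) f; have [q kq] := step (j w) g.
pose z (s : R) := p + s *: (q - p).
(* resolvents along the segment, with the given v and w at its ends *)
have [J Jp] : {J : R -> V & forall s, subgradient_at j phi (J s) (k *: (z s - j (J s)))
    /\ (s = 0 -> J s = v) /\ (s = 1 -> J s = w)}.
  apply: (@choice _ _ (fun s u => subgradient_at j phi u (k *: (z s - j u))
    /\ (s = 0 -> u = v) /\ (s = 1 -> u = w))) => s.
  have [->|s0] := eqVneq s 0.
    exists v; split; last by split => // /esym/eqP; rewrite oner_eq0.
    by rewrite /z scale0r addr0 kp.
  have [->|s1] := eqVneq s 1.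
    exists w; split; last by split => // /eqP; rewrite oner_eq0.
    by rewrite /z scale1r subrKC kq.
  have [u hu] := resolvent (z s) ok.
  by exists u; split => //; split => /eqP; rewrite ?(negbTE s0) ?(negbTE s1).
pose f' s := fine (psi (j (J s))) - fine (phi (J s)).
suff : f' 1 - f' 0 <= 0 * (1 - 0).
  have [_ [J0 _]] := Jp 0; have [_ [_ J1]] := Jp 1.
  by rewrite /f' (J0 erefl) (J1 erefl) mul0r subr_le0.
apply: (@increment_le _ f' 0 1 0 (k * `|q - p| ^+ 2)) => //.
  by rewrite mulr_ge0// sqr_ge0.
move=> s t _ _ _; rewrite mul0r add0r.
have phi_ineq a b :
    fine (phi (J a)) + k * dot (z a - j (J a)) (j (J b) - j (J a)) <= fine (phi (J b)).
  have [[aD ha] _] := Jp a; have [[bD _] _] := Jp b.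
  have := ha (J b); rewrite (effdom_fineK phi_Ny aD) (effdom_fineK phi_Ny bD) -EFinD lee_fin /=.
  by rewrite dotZl.
have psi_ineq a b :
    fine (psi (j (J a))) + k * dot (z a - j (J a)) (j (J b) - j (J a))
      <= fine (psi (j (J b))).
  have [/H_functional_subgradient[aD ha] _] := Jp a.
  have [/H_functional_subgradient[bD _] _] := Jp b.
  have := ha (j (J b)); rewrite (effdom_fineK psiN aD) (effdom_fineK psiN bD) -EFinD lee_fin /=.
  by rewrite dotZl.
have zz : z t - z s = (t - s) *: (q - p) by rewrite /z opprD addrACA subrr add0r -scalerBl.
have h1 := envelope_le k0 (psi_ineq s t) (psi_ineq t s) (q := z t).
have h2 := envelope_ge (z t) k0 (phi_ineq s t).
move: h1 h2; rewrite zz normrZ exprMn real_normK ?num_real// /f'; lra.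
Qed.

Lemma H_functional_shift : exists c, forall v f,
  subgradient_at j phi v f -> psi (j v) = (phi v + c%:E)%E.
Proof.
have [psiN _ _ _ _] := psiH.
have o1 : omega < omega + 1 by rewrite ltrDl.
have [v0 s0] := resolvent 0 o1.
exists (fine (psi (j v0)) - fine (phi v0)) => v f vf.
have [vD _] := vf; have [jvD _] := H_functional_subgradient vf.
rewrite (effdom_fineK phi_Ny vD) (effdom_fineK psiN jvD) -EFinD; congr EFin => /=.
have := H_functional_shift_le vf s0; have := H_functional_shift_le s0 vf; lra.
Qed.

(** The common resolvents are inserted into the subgradient inequalities of phi and
    psi and k tends to infinity: on H by norm lower semicontinuity, on V by weak
    compactness, which also yields a point of the fibre. *)
Lemma H_functionalE : exists c,
  (forall v, (psi (j v) <= phi v + c%:E)%E) /\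
  (forall u (r : R), psi u = r%:E -> exists2 v, j v = u & (phi v + c%:E <= r%:E)%E).
Proof.
have [psiN _ _ psil _] := psiH.
have [c hc] := H_functional_shift; exists c; split=> [v|u r er].
  have := phi_Ny v; case e : (phi v) => [s| |//] _; last by rewrite leey.
  have o1 : omega < omega + 1 by rewrite ltrDl.
  have [v0 /H_functional_subgradient s0] := resolvent 0 o1.
  apply: (lsc_penalty psiN psil s0 omega_ge0) => k ok.
  have k0 : 0 <= k by apply: le_trans omega_ge0 (ltW ok).
  have [x hx] := resolvent (j v) ok; exists (j x); rewrite /penalized (hc _ _ hx).
  have [xD /(_ v)] := hx; have [t ->] := effdom_real phi_Ny xD.
  rewrite e -!EFinD !lee_fin dotZl L2_dot_norm (distrC (j v)) /=.
  have : 0 <= k * `|j x - j v| ^+ 2 by rewrite mulr_ge0 ?sqr_ge0.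
  lra.
have [v jv hv] : exists2 v, j v = u & (phi v <= (r - c)%:E)%E.
  apply: (penalty_attained j_weak phi_Ny phi_convex phi_lsc omega_ge0 phi_coercive) => k ok.
  have k0 : 0 <= k by apply: le_trans omega_ge0 (ltW ok).
  have [x hx] := resolvent u ok; exists x; rewrite /penalized.
  have [xD _] := hx; have [t et] := effdom_real phi_Ny xD.
  have [_ /(_ u)] := H_functional_subgradient hx.
  rewrite (hc _ _ hx) er et -!EFinD !lee_fin dotZl L2_dot_norm (distrC u) /=.
  have : 0 <= k * `|j x - u| ^+ 2 by rewrite mulr_ge0 ?sqr_ge0.
  lra.
exists v => //; move: hv; have := phi_Ny v; case: (phi v) => [s| |]//= _.
by rewrite -EFinD !lee_fin; lra.
Qed.

End H_functional.

(** * Contraction and increments of the semigroups *)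

Section semigroup.
Context d (T : measurableType d) (R : realType) (mu : {measure set T -> \bar R}).
Local Notation H := (LspaceType2 mu).
Local Notation dot := (@L2_dot d T R mu).
Local Notation leb := (@lebesgue_measure R).

Lemma W1infty_loc_cst (x : H) : W1infty_loc (fun=> x) (fun=> 0 : H).
Proof.
split=> [|s t h _ _].
  split=> [|a b _ _].
    exists (fun _ _ => 0); split=> [n|].
      split; first by apply: (@sub_finite_set _ _ [set 0]) => // _ [r _ <-].
      move=> h; have [->|h0] := eqVneq h 0.
        by rewrite (_ : _ @^-1` _ = setT)//; apply/seteqP; split.
      rewrite (_ : _ @^-1` _ = set0)//; apply/seteqP; split => // r /= /esym/eqP.
      by rewrite (negbTE h0).
    exists set0; split => // r /= h; apply: h => _; exact: cvg_cst.
  exists 0; exists set0; split => // r /= h; apply: h => _; by rewrite normr0.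
by rewrite subrr dot0l Rintegral_cst// mul0r.
Qed.

Lemma subgradient_monotone (V : tvsType R) (j : {linear V -> H}) (phi : V -> \bar R) v w f g :
  never_Ny phi -> subgradient_at j phi v f -> subgradient_at j phi w g ->
  0 <= dot (f - g) (j v - j w).
Proof.
move=> pN [vD hv] [wD hw].
have [r er] := effdom_real pN vD; have [s es] := effdom_real pN wD.
have := hv w; have := hw v; rewrite er es -!EFinD !lee_fin !dotE; lra.
Qed.

Context (V : tvsType R) (j : {linear V -> H}) (phi : V -> \bar R).
Hypothesis phi_Ny : never_Ny phi.
Hypothesis phi_convex : convex_functional phi.
Context (S : R -> H -> H).
Hypothesis phi_dense : dense (j @` effdom phi).
Hypothesis S_gen : generates j phi S.

Lemma semigroup_solution z : solution j phi z (S ^~ z).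
Proof.
apply: S_gen => B Bz.
have [x [Bx Dx]] : B° `&` (j @` effdom phi) !=set0.
  apply: phi_dense; last exact: open_interior.
  by exists z.
by exists x; split => //; exact: interior_subset Bx.
Qed.

Lemma semigroup_trajectory z : exists g,
  [/\ {within `[0, +oo[, continuous (S ^~ z)}, S 0 z = z, W1infty_loc (S ^~ z) g &
    {ae leb, forall t, 0 < t -> exists2 v, j v = S t z & subgradient_at j phi v (- g t)}].
Proof.
have [cS S0 [g W hg]] := semigroup_solution z; exists g; split=> //.
by apply: ae_leb_sub hg => t + t0 => /(_ t0)/(jsubgradP j phi_Ny phi_convex).
Qed.

Lemma semigroup0 z : S 0 z = z.
Proof. by have [g []] := semigroup_trajectory z. Qed.

Lemma semigroup_continuous0 z (e : R) : 0 < e ->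
  exists2 del : R, 0 < del & forall s, 0 <= s -> s < del -> `|S s z - z| < e.
Proof.
move=> e0; have [g [cS S0 _ _]] := semigroup_trajectory z.
have [del del0 h] := continuous_at0 cS e0; exists del => // s s0 sd.
by rewrite distrC -[X in `|X - _|]S0; exact: h.
Qed.

Lemma semigroup_contraction t z z' : 0 <= t -> `|S t z - S t z'| <= `|z - z'|.
Proof.
rewrite le_eqVlt => /predU1P[<-|t0]; first by rewrite !semigroup0.
have [g [cS S0 W hg]] := semigroup_trajectory z.
have [g' [cS' S0' W' hg']] := semigroup_trajectory z'.
have := @trajectory_increment0 _ _ _ mu _ _ _ _ t 0 (fun x => 2^-1 * `|x| ^+ 2) id W W' t0 cS cS'
  (@sqr_norm_increment _ _ _ mu) (fun x y => lexx _).
rewrite S0 S0' mul0r -mulrBr => h.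
have {h} : 2^-1 * (`|S t z - S t z'| ^+ 2 - `|z - z'| ^+ 2) <= 0.
  apply: h; apply: ae_leb_sub (ae_leb_and hg hg') => r [h1 h2] r0 _.
  have [v <- sv] := h1 r0; have [v' <- sv'] := h2 r0.
  have := subgradient_monotone phi_Ny sv sv'.
  by rewrite -opprD dotNl oppr_ge0.
rewrite pmulr_rle0 ?invr_gt0// subr_le0 ler_sqr// ?nnegrE//.
Qed.

(** Monotonicity of the subgradient, tested against f at v, bounds the derivative
    of half the squared distance of S s z to j v by dot f (j v - S s z). *)
Lemma semigroup_increment v f z (tau del : R) : subgradient_at j phi v f -> 0 < tau ->
  (forall s, 0 <= s -> s <= tau -> `|S s z - z| <= del) ->
  `|S tau z - j v| ^+ 2 - `|z - j v| ^+ 2 <= 2 * tau * (dot f (j v - z) + del * `|f|).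
Proof.
move=> vf tau0 hdel; have [g [cS S0 W hg]] := semigroup_trajectory z.
have cc : {within `[0, +oo[, continuous (fun _ : R => j v)} by move=> x; exact: cvg_cst.
have := @trajectory_increment0 _ _ _ mu _ _ _ _ tau (dot f (j v - z) + del * `|f|)
  (fun x => 2^-1 * `|x| ^+ 2) id W (W1infty_loc_cst (j v)) tau0 cS cc
  (@sqr_norm_increment _ _ _ mu) (fun x y => lexx _).
rewrite S0 => h.
suff : 2^-1 * `|S tau z - j v| ^+ 2 - 2^-1 * `|z - j v| ^+ 2 <=
  (dot f (j v - z) + del * `|f|) * tau by lra.
apply: h; apply: ae_leb_sub hg => r + r0 rtau => /(_ r0)[w jw sw].
rewrite subr0 -jw.
have h1 := subgradient_monotone phi_Ny sw vf.
have h2 : dot (g r) (j w - j v) <= dot f (j v - j w).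
  by move: h1; rewrite !dotE; lra.
apply: (le_trans h2).
have -> : j v - j w = (j v - z) + (z - j w) by rewrite subrKA.
rewrite dotDr lerD2l; apply: (le_trans (cauchy_schwarz _ _)).
by rewrite mulrC ler_wpM2r// distrC jw; apply: hdel => //; exact: ltW.
Qed.

End semigroup.

(** * Resolvents preserve invariant convex sets *)

Section approximate_projection.
Context d (T : measurableType d) (R : realType) (mu : {measure set T -> \bar R}).
Local Notation H := (LspaceType2 mu).
Local Notation dot := (@L2_dot d T R mu).

Definition sqdist (x z : H * H) : R := `|z.1 - x.1| ^+ 2 + `|z.2 - x.2| ^+ 2.

Lemma sqdist_ge0 x z : 0 <= sqdist x z.
Proof. by rewrite addr_ge0// sqr_ge0. Qed.

Context (K : set (H * H)).
Hypothesis K_convex : forall z z' (t : R), K z -> K z' -> 0 <= t <= 1 ->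
  K (t *: z.1 + (1 - t) *: z'.1, t *: z.2 + (1 - t) *: z'.2).
Context (x p : H * H).
Hypothesis Kp : K p.

Definition dist2K := inf [set sqdist x z | z in K].

Let has_infK : has_inf [set sqdist x z | z in K].
Proof.
split; first by exists (sqdist x p), p.
by exists 0 => _ [z _ <-]; exact: sqdist_ge0.
Qed.

Lemma dist2K_ge0 : 0 <= dist2K.
Proof. by apply: lb_le_inf => [|_ [z _ <-]]; [exact: has_infK.1|exact: sqdist_ge0]. Qed.

Lemma dist2K_le z : K z -> dist2K <= sqdist x z.
Proof. by move=> Kz; apply: ge_inf; [exact: has_infK.2|exists z]. Qed.

Lemma dist2K_adherent (e : R) : 0 < e -> exists2 z, K z & sqdist x z < dist2K + e.
Proof. by move=> e0; have [_ [z Kz <-] h] := inf_adherent e0 has_infK; exists z. Qed.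

(** By the parallelogram identity, points of K whose distance to x is almost
    minimal are close to each other. *)
Lemma near_minimizers_close (z z' : H * H) (e : R) : K z -> K z' ->
  sqdist x z <= dist2K + e -> sqdist x z' <= dist2K + e -> sqdist z z' <= 4 * e.
Proof.
move=> Kz Kz' hz hz'.
have t01 : 0 <= (2^-1 : R) <= 1 by apply/andP; split; lra.
have := dist2K_le (K_convex Kz Kz' t01).
rewrite /sqdist/= in hz hz' *.
rewrite (norm_midpoint z.1 z'.1 x.1) (norm_midpoint z.2 z'.2 x.2); lra.
Qed.

(** The obtuse angle condition for projections, up to an error: it compares z
    with the point of K reached by moving from z towards p by the fraction
    eta. *)
Lemma near_minimizer_angle (z : H * H) (eta : R) : K z -> 0 < eta -> eta <= 1 ->
  sqdist x z <= dist2K + eta ^+ 2 ->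
  2 * (dot (p.1 - z.1) (x.1 - z.1) + dot (p.2 - z.2) (x.2 - z.2))
    <= eta * (1 + sqdist z p).
Proof.
move=> Kz eta0 eta1.
move=> hz.
have t01 : 0 <= eta <= 1 by rewrite (ltW eta0).
have := dist2K_le (K_convex Kp Kz t01); rewrite /sqdist/=.
rewrite (norm_segment eta p.1 z.1 x.1) (norm_segment eta p.2 z.2 x.2) => h.
rewrite -(ler_pM2l eta0).
move: hz h; rewrite /sqdist; lra.
Qed.

Context (S1 S2 : R -> H -> H) (k : R) (y : H * H).
Hypothesis k_gt0 : 0 < k.
Hypothesis y1E : y.1 = k *: (p.1 - x.1).
Hypothesis y2E : y.2 = k *: (p.2 - x.2).
Hypothesis K_inv : forall t z, 0 <= t -> K z -> K (S1 t z.1, S2 t z.2).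
Hypothesis S1_contraction : forall t z z', 0 <= t -> `|S1 t z - S1 t z'| <= `|z - z'|.
Hypothesis S2_contraction : forall t z z', 0 <= t -> `|S2 t z - S2 t z'| <= `|z - z'|.
Hypothesis S1_continuous0 : forall z e, 0 < e ->
  exists2 del : R, 0 < del & forall s, 0 <= s -> s < del -> `|S1 s z - z| < e.
Hypothesis S2_continuous0 : forall z e, 0 < e ->
  exists2 del : R, 0 < del & forall s, 0 <= s -> s < del -> `|S2 s z - z| < e.
Hypothesis S1_increment : forall z (tau del : R), 0 < tau ->
  (forall s, 0 <= s -> s <= tau -> `|S1 s z - z| <= del) ->
  `|S1 tau z - x.1| ^+ 2 - `|z - x.1| ^+ 2 <= 2 * tau * (dot y.1 (x.1 - z) + del * `|y.1|).
Hypothesis S2_increment : forall z (tau del : R), 0 < tau ->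
  (forall s, 0 <= s -> s <= tau -> `|S2 s z - z| <= del) ->
  `|S2 tau z - x.2| ^+ 2 - `|z - x.2| ^+ 2 <= 2 * tau * (dot y.2 (x.2 - z) + del * `|y.2|).

Lemma displacement_le (S : R -> H -> H) (z0 z : H) (s e : R) :
  (forall t z z', 0 <= t -> `|S t z - S t z'| <= `|z - z'|) ->
  0 <= s -> 0 <= e -> `|S s z0 - z0| <= e -> `|z - z0| ^+ 2 <= 4 * e ^+ 2 ->
  `|S s z - z| <= 5 * e.
Proof.
move=> Sc s0 e0 h1 h2.
have {}h2 : `|z - z0| <= 2 * e.
  by rewrite -ler_sqr ?nnegrE ?mulr_ge0// exprMn -natrX.
have -> : S s z - z = (S s z - S s z0) + (S s z0 - z0) + (z0 - z).
  by rewrite subrKA subrKA.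
apply: (le_trans (ler_normD _ _)); rewrite (distrC z0).
have := ler_normD (S s z - S s z0) (S s z0 - z0); have := Sc s z z0 s0; lra.
Qed.

(** A first near-minimizer z0 determines a time tau up to which the semigroups
    move z0 by less than eta. A much better near-minimizer z, chosen after tau,
    is close to z0, and contractivity controls its motion up to tau as well. Its
    image at time tau lies in K, hence is not much nearer to x than z is, and the
    increment estimate gives dot y (x - z) >= - O(eta). Together with
    y = k (p - x) and the angle condition this bounds k |x - z|^2. *)
Lemma dist2K_bound (eta : R) : 0 < eta -> eta <= 1 ->
  k * dist2K <= eta * (k / 2 * (1 + (2 * sqdist x p + 2 * (dist2K + 1)))
                       + (2^-1 + 5 * (`|y.1| + `|y.2|))).
Proof.
move=> eta0 eta1.
have eta20 : 0 < eta ^+ 2 by rewrite exprn_gt0.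
have [z0 Kz0 hz0] := dist2K_adherent eta20.
have [d1 d10 hd1] := S1_continuous0 z0.1 eta0.
have [d2 d20 hd2] := S2_continuous0 z0.2 eta0.
pose tau := Num.min d1 d2 / 2.
have m0 : 0 < Num.min d1 d2 by rewrite lt_min d10.
have tau0 : 0 < tau by rewrite divr_gt0.
have : tau < Num.min d1 d2 by rewrite ltr_pdivrMr// ltr_pMr// ltr1n.
rewrite lt_min => /andP[td1 td2].
have m'0 : 0 < Num.min (eta ^+ 2) (eta * tau) by rewrite lt_min eta20 mulr_gt0.
have [z Kz hz] := dist2K_adherent m'0.
have hz1 : sqdist x z <= dist2K + eta ^+ 2.
  by apply: (le_trans (ltW hz)); rewrite lerD2l ge_min lexx.
have hz2 : sqdist x z <= dist2K + eta * tau.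
  by apply: (le_trans (ltW hz)); rewrite lerD2l ge_min lexx orbT.
have hzz : `|z.1 - z0.1| ^+ 2 + `|z.2 - z0.2| ^+ 2 <= 4 * eta ^+ 2.
  exact: near_minimizers_close Kz0 Kz (ltW hz0) hz1.
have q1 : `|z.1 - z0.1| ^+ 2 <= 4 * eta ^+ 2.
  by apply: le_trans hzz; rewrite lerDl sqr_ge0.
have q2 : `|z.2 - z0.2| ^+ 2 <= 4 * eta ^+ 2.
  by apply: le_trans hzz; rewrite lerDr sqr_ge0.
have i1 := S1_increment (z := z.1) (del := 5 * eta) tau0.
have {}i1 := i1 (fun s s0 st => displacement_le S1_contraction s0 (ltW eta0)
  (ltW (hd1 s s0 (le_lt_trans st td1))) q1).
have i2 := S2_increment (z := z.2) (del := 5 * eta) tau0.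
have {}i2 := i2 (fun s s0 st => displacement_le S2_contraction s0 (ltW eta0)
  (ltW (hd2 s s0 (le_lt_trans st td2))) q2).
have i3 := dist2K_le (K_inv (ltW tau0) Kz).
have i4 : 0 <= eta * tau + 2 * tau * (dot y.1 (x.1 - z.1) + dot y.2 (x.2 - z.2)
    + 5 * eta * (`|y.1| + `|y.2|)).
  move: i1 i2 i3 hz2; rewrite /sqdist/=; lra.
have {i4} i4 : 0 <= eta / 2 + (dot y.1 (x.1 - z.1) + dot y.2 (x.2 - z.2)
    + 5 * eta * (`|y.1| + `|y.2|)).
  rewrite -(pmulr_rge0 _ tau0) -(@pmulr_rge0 _ 2)//; apply: (le_trans i4); lra.
have i5 := near_minimizer_angle Kz eta0 eta1 hz1.
have i6 : sqdist z p <= 2 * sqdist x p + 2 * (dist2K + 1).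
  have e21 : eta ^+ 2 <= 1 by rewrite expr_le1// ltW.
  have := sqr_norm_triangle p.1 z.1 x.1; have := sqr_norm_triangle p.2 z.2 x.2.
  move: hz1 e21; rewrite /sqdist; lra.
have i7 := dist2K_le Kz.
rewrite y1E y2E !dotZl !dot_subr_split -y1E -y2E in i4.
have i8 := ler_wpM2l (ltW k_gt0) i7.
have i9 := ler_wpM2l (ltW k_gt0) i5.
have i10 : k * (eta * (1 + sqdist z p)) <= k * (eta * (1 + (2 * sqdist x p + 2 * (dist2K + 1)))).
  by rewrite ler_wpM2l ?(ltW k_gt0)// ler_wpM2l ?(ltW eta0)// lerD2l.
rewrite /sqdist in i8.
move: (sqdist x p) (sqdist z p) i4 i8 i9 i10 => A B; lra.
Qed.

(** Both components of x are resolvents, and y is the corresponding subgradient: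
    the increment hypotheses hold for the trajectories compared with x. The
    distance from x to K vanishes by dist2K_bound with eta -> 0. *)
Lemma invariant_near_resolvent (e : R) : 0 < e -> exists2 z, K z & sqdist x z < e.
Proof.
move=> e0; suff d0 : dist2K <= 0.
  have [z Kz hz] := dist2K_adherent e0; exists z => //; lra.
rewrite -(pmulr_rle0 _ k_gt0).
set A := k / 2 * (1 + (2 * sqdist x p + 2 * (dist2K + 1))) + (2^-1 + 5 * (`|y.1| + `|y.2|)).
have A0 : 0 < A.
  have := sqdist_ge0 x p; have := dist2K_ge0 => h1 h2.
  have q : 0 <= k / 2 * (1 + (2 * sqdist x p + 2 * (dist2K + 1))).
    by rewrite mulr_ge0 ?divr_ge0 ?(ltW k_gt0)//; lra.
  by rewrite /A; have := normr_ge0 y.1; have := normr_ge0 y.2; lra.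
apply/ler_addgt0Pr => eps eps0; rewrite add0r.
pose eta := Num.min 1 (eps / A).
have eta0 : 0 < eta by rewrite lt_min ltr01 divr_gt0.
have eta1 : eta <= 1 by rewrite ge_min lexx.
apply: (le_trans (dist2K_bound eta0 eta1)).
by rewrite -ler_pdivlMr// ge_min lexx orbT.
Qed.

End approximate_projection.

(** * Domination and the ordering of resolvents *)

Section comparison.
Context d (T : measurableType d) (R : realType) (mu : {measure set T -> \bar R}).
Local Notation H := (LspaceType2 mu).
Context (V1 V2 : tvsType R) (j1 : {linear V1 -> H}) (j2 : {linear V2 -> H}).
Context (phi1 : V1 -> \bar R) (phi2 : V2 -> \bar R).
Hypothesis phi1_Ny : never_Ny phi1.
Hypothesis phi2_Ny : never_Ny phi2.
Hypothesis phi1_convex : convex_functional phi1.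
Hypothesis phi2_convex : convex_functional phi2.
Context (S1 S2 : R -> H -> H) (C : set H).
Hypothesis dense1 : dense (j1 @` effdom phi1).
Hypothesis dense2 : dense (j2 @` effdom phi2).
Hypothesis gen1 : generates j1 phi1 S1.
Hypothesis gen2 : generates j2 phi2 S2.
Hypothesis C_convex : convex_set C.
Hypothesis C_inv1 : leaves_invariant S1 C.
Hypothesis C_inv2 : leaves_invariant S2 C.

(** The points w1 and w2 that the inequality provides are inserted into the
    subgradient inequalities at v1 and v2. Since their images differ from j1 v1
    and j2 v2 by the positive part of j1 v1 - j2 v2, with opposite signs, the
    derivative of half its squared norm is nonpositive. *)
Lemma domination_of_lattice_inequality :
  (forall v1 v2, effdom phi1 v1 -> effdom phi2 v2 -> C (j1 v1) -> C (j2 v2) ->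
    exists w1 w2, [/\ effdom phi1 w1, effdom phi2 w2,
      Lp_min (j1 v1) (j2 v2) = j1 w1, Lp_max (j1 v1) (j2 v2) = j2 w2 &
      (phi1 w1 + phi2 w2 <= phi1 v1 + phi2 v2)%E]) ->
  forall u v, C u -> C v -> Lp_le u v -> forall t, 0 <= t -> Lp_le (S1 t u) (S2 t v).
Proof.
move=> h u v Cu Cv uv t; rewrite le_eqVlt => /predU1P[<-|t0].
  rewrite (semigroup0 phi1_Ny phi1_convex dense1 gen1).
  by rewrite (semigroup0 phi2_Ny phi2_convex dense2 gen2).
have [g1 [c1 S10 W1 h1]] := semigroup_trajectory phi1_Ny phi1_convex dense1 gen1 u.
have [g2 [c2 S20 W2 h2]] := semigroup_trajectory phi2_Ny phi2_convex dense2 gen2 v.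
have := @trajectory_increment0 _ _ _ mu _ _ _ _ t 0 (fun x => 2^-1 * `|Lp_pos x| ^+ 2)
  (@Lp_pos _ _ _ mu) W1 W2 t0 c1 c2 (@Lp_pos_increment _ _ _ mu) (fun x y => Lp_pos_lip y x).
rewrite S10 S20 ((Lp_leP _ _).1 uv) normr0 expr0n/= mulr0 subr0 mul0r => fin.
apply/Lp_leP/eqP; rewrite -normr_eq0 -sqrf_eq0 eq_le sqr_ge0 andbT.
rewrite -(@pmulr_rle0 _ 2^-1) ?invr_gt0//; apply: fin.
apply: ae_leb_sub (ae_leb_and h1 h2) => r [k1 k2] r0 _.
have [v1 e1 [d1 s1]] := k1 r0; have [v2 e2 [d2 s2]] := k2 r0.
have Cv1 : C (j1 v1) by rewrite e1; apply: (C_inv1 (ltW r0)); exists u.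
have Cv2 : C (j2 v2) by rewrite e2; apply: (C_inv2 (ltW r0)); exists v.
rewrite -e1 -e2.
have [w1 [w2 [dw1 dw2 m1 m2 le12]]] := h v1 v2 d1 d2 Cv1 Cv2.
have := s1 w1; have := s2 w2; rewrite -m1 -m2 Lp_min_subpos Lp_max_addpos.
have -> : j1 v1 - Lp_pos (j1 v1 - j2 v2) - j1 v1 = - Lp_pos (j1 v1 - j2 v2).
  by rewrite addrAC subrr add0r.
have -> : j2 v2 + Lp_pos (j1 v1 - j2 v2) - j2 v2 = Lp_pos (j1 v1 - j2 v2).
  by rewrite addrAC subrr add0r.
move: le12.
have [a1 ->] := effdom_real phi1_Ny d1; have [a2 ->] := effdom_real phi2_Ny d2.
have [b1 ->] := effdom_real phi1_Ny dw1; have [b2 ->] := effdom_real phi2_Ny dw2.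
by rewrite -!EFinD !lee_fin !dotNl !dotNr dotBl; lra.
Qed.

(** The pairs of ordered points of C form a convex set invariant under the product
    semigroup, and the order is closed. *)
Lemma resolvent_le (k : R) p1 p2 v1 v2 :
  (forall u v, C u -> C v -> Lp_le u v -> forall t, 0 <= t -> Lp_le (S1 t u) (S2 t v)) ->
  0 < k -> C p1 -> C p2 -> Lp_le p1 p2 ->
  subgradient_at j1 phi1 v1 (k *: (p1 - j1 v1)) ->
  subgradient_at j2 phi2 v2 (k *: (p2 - j2 v2)) ->
  Lp_le (j1 v1) (j2 v2).
Proof.
move=> h k0 Cp1 Cp2 p12 s1 s2.
pose K : set (H * H) := [set z | [/\ C z.1, C z.2 & Lp_le z.1 z.2]].
have Cc := (convex_setE C).1 C_convex.
have Kc z z' (t : R) : K z -> K z' -> 0 <= t <= 1 ->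
    K (t *: z.1 + (1 - t) *: z'.1, t *: z.2 + (1 - t) *: z'.2).
  by move=> [a b c] [a' b' c'] t01; split => /=; [exact: Cc|exact: Cc|exact: Lp_le_convex].
have Ki t z : 0 <= t -> K z -> K (S1 t z.1, S2 t z.2).
  move=> t0 [a b c]; split => /=.
  - by apply: (C_inv1 t0); exists z.1.
  - by apply: (C_inv2 t0); exists z.2.
  - exact: h.
apply: Lp_le_closed => e e0.
have [|[z1 z2] [_ _ zz] hz] := @invariant_near_resolvent _ _ _ mu K Kc (j1 v1, j2 v2) (p1, p2) _
  S1 S2 k (k *: (p1 - j1 v1), k *: (p2 - j2 v2)) k0 erefl erefl Ki
  (semigroup_contraction phi1_Ny phi1_convex dense1 gen1)
  (semigroup_contraction phi2_Ny phi2_convex dense2 gen2)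
  (semigroup_continuous0 phi1_Ny phi1_convex dense1 gen1)
  (semigroup_continuous0 phi2_Ny phi2_convex dense2 gen2)
  (fun z tau del => semigroup_increment phi1_Ny phi1_convex dense1 gen1 s1)
  (fun z tau del => semigroup_increment phi2_Ny phi2_convex dense2 gen2 s2) e e0.
  by [].
by exists z1, z2.
Qed.

End comparison.

(** * The lattice inequality for envelopes and its limit *)

Section lattice_inequality.
Context d (T : measurableType d) (R : realType) (mu : {measure set T -> \bar R}).
Local Notation H := (LspaceType2 mu).
Local Notation dot := (@L2_dot d T R mu).

Lemma subgradient_minimizer (V : tvsType R) (j : {linear V -> H}) (phi : V -> \bar R) k p v0 v :
  never_Ny phi -> 0 <= k -> subgradient_at j phi v0 (k *: (p - j v0)) ->
  (penalized j phi k p v0 <= penalized j phi k p v)%E.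
Proof.
move=> pN k0 [v0D /(_ v)]; rewrite /penalized.
have [r er] := effdom_real pN v0D; rewrite er.
have := pN v; case: (phi v) => [s| |//] _; last by move=> _; rewrite addye// leey.
rewrite -!EFinD !lee_fin dotZl => h.
have := mulr_ge0 k0 (sqr_ge0 `|j v - j v0|).
have -> : `|j v - j v0| ^+ 2 =
    `|j v - p| ^+ 2 - `|j v0 - p| ^+ 2 + 2 * dot (p - j v0) (j v - j v0).
  rewrite -!L2_dot_norm !dotE (dotC p (j v)) (dotC p (j v0)) (dotC (j v0) (j v)); ring.
lra.
Qed.

Context (V1 V2 : tvsType R) (j1 : {linear V1 -> H}) (j2 : {linear V2 -> H}).
Context (phi1 : V1 -> \bar R) (phi2 : V2 -> \bar R) (C : set H).
Hypothesis C_convex : convex_set C.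
Hypothesis C_min : forall u v, C u -> C v -> C (Lp_min u v).
Hypothesis C_max : forall u v, C u -> C v -> C (Lp_max u v).

(** Along a + s w and u2 + s w, with a the minimum of u1 and u2 and w the positive
    part of u1 - u2, the derivatives of the envelopes are k <a + s w - x1 s, w>
    and k <u2 + s w - x2 s, w>, where x1 s and x2 s are the resolvents. The first
    is at least the second, because <a - u2, w> = 0 and x1 s <= x2 s. *)
Lemma envelope_lattice_inequality (psi1 psi2 : H -> \bar R) k u1 u2 :
  0 <= k -> never_Ny psi1 -> never_Ny psi2 ->
  (forall v f, subgradient_at j1 phi1 v f -> subgradient_at idfun psi1 (j1 v) f) ->
  (forall v f, subgradient_at j2 phi2 v f -> subgradient_at idfun psi2 (j2 v) f) ->
  (forall p, exists v, subgradient_at j1 phi1 v (k *: (p - j1 v))) ->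
  (forall p, exists v, subgradient_at j2 phi2 v (k *: (p - j2 v))) ->
  (forall p1 p2 v1 v2, C p1 -> C p2 -> Lp_le p1 p2 ->
     subgradient_at j1 phi1 v1 (k *: (p1 - j1 v1)) ->
     subgradient_at j2 phi2 v2 (k *: (p2 - j2 v2)) -> Lp_le (j1 v1) (j2 v2)) ->
  C u1 -> C u2 ->
  exists x1 x2, [/\ subgradient_at idfun psi1 x1 (k *: (Lp_min u1 u2 - x1)),
    subgradient_at idfun psi2 x2 (k *: (Lp_max u1 u2 - x2)) &
    (penalized idfun psi1 k (Lp_min u1 u2) x1 + penalized idfun psi2 k (Lp_max u1 u2) x2 <=
     psi1 u1 + psi2 u2)%E].
Proof.
move=> k0 N1 N2 sub1 sub2 res1 res2 ord Cu1 Cu2.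
set w := Lp_pos (u1 - u2); set a := Lp_min u1 u2; set b := Lp_max u1 u2.
have aw : a + w = u1 by rewrite /a /w Lp_min_subpos subrK.
have bw : u2 + w = b by rewrite /b /w Lp_max_addpos.
have awE : a - u2 = (u1 - u2) - w by rewrite -aw addrAC addrK.
have Cc := (convex_setE C).1 C_convex.
have Ca : C a by exact: C_min.
have Cb : C b by exact: C_max.
have seg (p q : H) (s : R) : p + s *: q = s *: (p + q) + (1 - s) *: p.
  by rewrite scalerDr scalerBl scale1r addrAC subrKC addrC.
have [J1 hJ1] := choice (fun s : R => res1 (a + s *: w)).
have [J2 hJ2] := choice (fun s : R => res2 (u2 + s *: w)).
pose x1 s := j1 (J1 s); pose x2 s := j2 (J2 s).
have sx1 s : subgradient_at idfun psi1 (x1 s) (k *: (a + s *: w - x1 s)).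
  by apply: sub1; exact: hJ1.
have sx2 s : subgradient_at idfun psi2 (x2 s) (k *: (u2 + s *: w - x2 s)).
  by apply: sub2; exact: hJ2.
have r1 s : psi1 (x1 s) = (fine (psi1 (x1 s)))%:E by apply: effdom_fineK; have [] := sx1 s.
have r2 s : psi2 (x2 s) = (fine (psi2 (x2 s)))%:E by apply: effdom_fineK; have [] := sx2 s.
pose E1 s := fine (psi1 (x1 s)) + k / 2 * `|a + s *: w - x1 s| ^+ 2.
pose E2 s := fine (psi2 (x2 s)) + k / 2 * `|u2 + s *: w - x2 s| ^+ 2.
have i1 s t : fine (psi1 (x1 s)) + k * dot (a + s *: w - x1 s) (x1 t - x1 s) <= fine (psi1 (x1 t)).
  by have [_ /(_ (x1 t))] := sx1 s; rewrite /= r1 (r1 t) -EFinD lee_fin dotZl.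
have i2 s t : fine (psi2 (x2 s)) + k * dot (u2 + s *: w - x2 s) (x2 t - x2 s) <= fine (psi2 (x2 t)).
  by have [_ /(_ (x2 t))] := sx2 s; rewrite /= r2 (r2 t) -EFinD lee_fin dotZl.
have ineq s : 0 <= s -> s <= 1 -> dot (u2 + s *: w - x2 s) w <= dot (a + s *: w - x1 s) w.
  move=> s0 s1; have s01 : 0 <= s <= 1 by rewrite s0.
  have C1 : C (a + s *: w) by rewrite seg aw; exact: Cc.
  have C2 : C (u2 + s *: w) by rewrite seg bw; exact: Cc.
  have le12 : Lp_le (a + s *: w) (u2 + s *: w).
    apply/Lp_leP; rewrite opprD addrACA subrr addr0.
    by apply/Lp_leP; exact: Lp_min_le.
  have /Lp_leP p0 := ord _ _ _ _ C1 C2 le12 (hJ1 s) (hJ2 s).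
  have := dot_pos_le (u1 - u2) (x1 s - x2 s); rewrite -/w p0 dot0r => hx.
  have hw : dot (a - u2) w = 0 by rewrite awE dotC dotBr /w dot_posl subrr.
  by move: hx hw; rewrite !dotE !(dotC _ w); lra.
have main : (E2 1 - E1 1) - (E2 0 - E1 0) <= 0 * (1 - 0).
  apply: (@increment_le _ (fun s => E2 s - E1 s) 0 1 0 (k * `|w| ^+ 2)) => //.
    by rewrite mulr_ge0 ?sqr_ge0.
  move=> s t s0 st t1; rewrite mul0r add0r.
  have zz (p : H) : p + t *: w - (p + s *: w) = (t - s) *: w.
    by rewrite opprD addrACA subrr add0r -scalerBl.
  have h2 := envelope_le k0 (i2 s t) (i2 t s) (q := u2 + t *: w).
  have h1 := envelope_ge (a + t *: w) k0 (i1 s t).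
  have ts : 0 <= k * (t - s) by rewrite mulr_ge0// subr_ge0.
  have := ler_wpM2l ts (ineq s s0 (le_trans st t1)).
  move: h1 h2; rewrite !zz normrZ exprMn real_normK ?num_real// !dotZr /E1 /E2; lra.
exists (x1 0), (x2 1); split.
- by have := sx1 0; rewrite scale0r addr0.
- by have := sx2 1; rewrite scale1r bw.
- have := N1 u1; case e1 : (psi1 u1) => [q1| |//] _; last first.
    by rewrite addye ?leey//; have := N2 u2; case: (psi2 u2).
  have := N2 u2; case e2 : (psi2 u2) => [q2| |//] _; last by rewrite addey ?leey.
  rewrite /penalized r1 r2 -!EFinD lee_fin /=.
  have [_ /(_ u1)] := sx1 1; have [_ /(_ u2)] := sx2 0.
  rewrite r1 r2 e1 e2 -!EFinD !lee_fin /= scale1r scale0r addr0 aw !dotZl !L2_dot_norm.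
  have n1 := mulr_ge0 k0 (sqr_ge0 `|u1 - x1 1|).
  have n2 := mulr_ge0 k0 (sqr_ge0 `|u2 - x2 0|).
  move: main; rewrite /E1 /E2 scale1r scale0r !addr0 aw bw.
  by rewrite -(distrC a) -(distrC b); lra.
Qed.

End lattice_inequality.

Section penalized_limit.
Context d (T : measurableType d) (R : realType) (mu : {measure set T -> \bar R}).
Local Notation H := (LspaceType2 mu).

Lemma penalized_real (psi : H -> \bar R) (k : R) p x f : never_Ny psi ->
  subgradient_at idfun psi x f -> exists m : R, penalized idfun psi k p x = m%:E.
Proof.
move=> N [xD _]; have [r er] := effdom_real N xD.
by rewrite /penalized er -EFinD; eexists.
Qed.

(** The envelopes increase with k. So the first one can be frozen at some k while
    the second reaches psi2 b, and then k tends to infinity in the first one. *)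
Lemma penalized_sum_limit (psi1 psi2 : H -> \bar R) (omega : R) a b (c : R) :
  never_Ny psi1 -> never_Ny psi2 -> lsc_functional psi1 -> lsc_functional psi2 -> 0 <= omega ->
  (forall k, omega < k -> exists x1 x2, [/\ subgradient_at idfun psi1 x1 (k *: (a - x1)),
    subgradient_at idfun psi2 x2 (k *: (b - x2)) &
    (penalized idfun psi1 k a x1 + penalized idfun psi2 k b x2 <= c%:E)%E]) ->
  (psi1 a + psi2 b <= c%:E)%E.
Proof.
move=> N1 N2 l1 l2 o0 h.
have o1 : omega < omega + 1 by rewrite ltrDl.
have [y1 [y2 [sy1 sy2 _]]] := h _ o1.
(* the first envelope frozen at k, below its values for k' > k *)
have step k x1 (m : R) : omega < k -> subgradient_at idfun psi1 x1 (k *: (a - x1)) ->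
    penalized idfun psi1 k a x1 = m%:E -> (psi2 b <= (c - m)%:E)%E.
  move=> ok s1 em; have k0 : 0 <= k by exact: le_trans (ltW ok).
  apply: (lsc_penalty N2 l2 sy2 k0) => k' kk'.
  have [z1 [z2 [t1 t2 hz]]] := h k' (lt_trans ok kk'); exists z2.
  have [m1 em1] := penalized_real k' a N1 t1; have [m2 em2] := penalized_real k' b N2 t2.
  move: hz; rewrite em1 em2 -EFinD !lee_fin => hz.
  suff : m <= m1 by lra.
  rewrite -lee_fin -em -em1.
  apply: (le_trans (subgradient_minimizer z1 N1 k0 s1)).
  apply: leeD2l; rewrite lee_fin ler_wpM2r ?sqr_ge0// ler_wpM2r ?invr_ge0//.
  exact: ltW.
have [B eB] : exists B : R, psi2 b = B%:E.
  have [m em] := penalized_real (omega + 1) a N1 sy1.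
  by apply: (effdom_real N2); apply: effdom_le (step _ _ _ o1 sy1 em).
have ha : (psi1 a <= (c - B)%:E)%E.
  apply: (lsc_penalty N1 l1 sy1 o0) => k ok.
  have [z1 [z2 [t1 t2 _]]] := h k ok; exists z1.
  have [m em] := penalized_real k a N1 t1.
  by have := step _ _ _ ok t1 em; rewrite eB em !lee_fin; lra.
rewrite eB; apply: (le_trans (leeD2r _ ha)).
by rewrite -EFinD subrK.
Qed.

End penalized_limit.

Theorem theorem3p5 (d : measure_display) (T : measurableType d) (R : realType)
  (mu : {measure set T -> \bar R})
  (V1 V2 : tvsType R)
  (j1 : {linear V1 -> LspaceType2 mu}) (j2 : {linear V2 -> LspaceType2 mu})
  (hj1 : weakly_continuous j1) (hj2 : weakly_continuous j2)
  (phi1 : V1 -> \bar R) (phi2 : V2 -> \bar R)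
  (phi1_Ny : never_Ny phi1) (phi2_Ny : never_Ny phi2)
  (phi1_convex : convex_functional phi1) (phi2_convex : convex_functional phi2)
  (phi1_proper : proper_functional phi1) (phi2_proper : proper_functional phi2)
  (phi1_lsc : lsc_functional phi1) (phi2_lsc : lsc_functional phi2)
  (phi1_elliptic : elliptic j1 phi1) (phi2_elliptic : elliptic j2 phi2)
  (dense1 : dense (j1 @` effdom phi1)) (dense2 : dense (j2 @` effdom phi2))
  (phi1H phi2H : LspaceType2 mu -> \bar R)
  (hphi1H : is_H_functional j1 phi1 phi1H)
  (hphi2H : is_H_functional j2 phi2 phi2H)
  (S1 S2 : R -> LspaceType2 mu -> LspaceType2 mu)
  (hS1 : generates j1 phi1 S1) (hS2 : generates j2 phi2 S2)
  (C : set (LspaceType2 mu))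
  (C_closed : closed C) (C_convex : convex_set C)
  (C_min : forall u v, C u -> C v -> C (Lp_min u v))
  (C_max : forall u v, C u -> C v -> C (Lp_max u v))
  (C_inv1 : leaves_invariant S1 C) (C_inv2 : leaves_invariant S2 C) :
  [<-> forall u v, C u -> C v -> Lp_le u v ->
         forall t : R, 0 <= t -> Lp_le (S1 t u) (S2 t v);
       forall u1 u2, C u1 -> C u2 ->
         (phi1H (Lp_min u1 u2) + phi2H (Lp_max u1 u2) <= phi1H u1 + phi2H u2)%E;
       forall (v1 : V1) (v2 : V2), effdom phi1 v1 -> effdom phi2 v2 ->
         C (j1 v1) -> C (j2 v2) ->
         exists (w1 : V1) (w2 : V2),
           [/\ effdom phi1 w1, effdom phi2 w2,
               Lp_min (j1 v1) (j2 v2) = j1 w1,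
               Lp_max (j1 v1) (j2 v2) = j2 w2 &
               (phi1 w1 + phi2 w2 <= phi1 v1 + phi2 v2)%E]].

Proof.
have [om1 om1_ge0 [_ co1]] := phi1_elliptic.
have [om2 om2_ge0 [_ co2]] := phi2_elliptic.
have [N1 cv1 _ l1 _] := hphi1H; have [N2 cv2 _ l2 _] := hphi2H.
tfae.
- move=> h u1 u2 Cu1 Cu2.
  pose om := Num.max om1 om2.
  have om0 : 0 <= om by rewrite le_max om1_ge0.
  have key k : om < k -> exists x1 x2,
      [/\ subgradient_at idfun phi1H x1 (k *: (Lp_min u1 u2 - x1)),
        subgradient_at idfun phi2H x2 (k *: (Lp_max u1 u2 - x2)) &
        (penalized idfun phi1H k (Lp_min u1 u2) x1 + penalized idfun phi2H k (Lp_max u1 u2) x2 <=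
         phi1H u1 + phi2H u2)%E].
    rewrite gt_max => /andP[k1 k2]; have k_gt0 : 0 < k by exact: le_lt_trans k1.
    apply: (envelope_lattice_inequality C_convex C_min C_max (ltW k_gt0) N1 N2
      (H_functional_subgradient phi1_Ny phi1_convex hphi1H)
      (H_functional_subgradient phi2_Ny phi2_convex hphi2H)) => //.
    + by move=> p; exact: (resolvent_exists _ _ _ hj1 _ _ om1_ge0 co1).
    + by move=> p; exact: (resolvent_exists _ _ _ hj2 _ _ om2_ge0 co2).
    + move=> p1 p2 v1 v2; exact: (resolvent_le phi1_Ny phi2_Ny phi1_convex phi2_convex
        dense1 dense2 hS1 hS2 C_convex C_inv1 C_inv2).
  move: key; have := N1 u1; case: (phi1H u1) => [r1| |//] _; last first.
    by move=> _; rewrite addye ?leey//; exact: N2.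
  have := N2 u2; case: (phi2H u2) => [r2| |//] _ key; last by rewrite addey ?leey.
  by apply: (penalized_sum_limit N1 N2 l1 l2 om0) => k /key.
- move=> h v1 v2 d1 d2 Cv1 Cv2.
  have [c1 [le1 att1]] := H_functionalE hj1 phi1_Ny phi1_convex
    phi1_proper phi1_lsc om1_ge0 co1 hphi1H.
  have [c2 [le2 att2]] := H_functionalE hj2 phi2_Ny phi2_convex
    phi2_proper phi2_lsc om2_ge0 co2 hphi2H.
  have [s1 e1] := effdom_real phi1_Ny d1; have [s2 e2] := effdom_real phi2_Ny d2.
  have := le_trans (h _ _ Cv1 Cv2) (leeD (le1 v1) (le2 v2)).
  rewrite e1 e2 -!EFinD.
  have := N1 (Lp_min (j1 v1) (j2 v2)); case f1 : (phi1H _) => [r1| |//] _; last first.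
    by rewrite addye// N2.
  have := N2 (Lp_max (j1 v1) (j2 v2)); case f2 : (phi2H _) => [r2| |//] _; last first.
    by rewrite addey.
  rewrite -EFinD lee_fin => hr.
  have [w1 jw1 /(sublevel_real phi1_Ny)[t1 g1 k1]] := att1 _ _ f1.
  have [w2 jw2 /(sublevel_real phi2_Ny)[t2 g2 k2]] := att2 _ _ f2.
  exists w1, w2; split => //; rewrite ?/effdom/= ?g1 ?g2 ?ltry//.
  by rewrite -!EFinD lee_fin; lra.
- move=> h; apply: (domination_of_lattice_inequality phi1_Ny phi2_Ny phi1_convex phi2_convex
    dense1 dense2 hS1 hS2 C_inv1 C_inv2) => v1 v2 d1 d2 Cv1 Cv2.
  by have [w1 [w2 hw]] := h v1 v2 d1 d2 Cv1 Cv2; exists w1, w2.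
Qed.
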